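(* Let $d=2$ or $d=3$, and let $\mu$ be a probability measure on the unit sphere $S^d$ whose Fréchet mean $\bar\mu$ is unique. Suppose that $\mu$ is absolutely continuous and rotationally symmetric about $\bar\mu$, i.e. $d\mu(q)=f(\mathbf{d}(\bar\mu,q))\,dV(q)$, and that $\mu$ gives zero mass to an open neighborhood of the cut locus of $\bar\mu$ (the antipode of $\bar\mu$). Then there is no smeary effect for $\mu$ on $S^d$.
   Context: $S^d$ carries its standard round metric; $\mathbf{d}$ is the great-circle distance and $dV$ the volume element. The Fréchet function of $\mu$ is $F(x)=\int_{S^d}\frac12\mathbf{d}^2(y,x)\,d\mu(y)$, and its Fréchet mean set is the set of global minimizers of $F$. The smeary effect is said to occur for $\mu$ when the Hessian $\nabla^2F$ vanishes at the mean $\bar\mu$ and some covariant derivative tensor $\nabla^rF$ of even order $r$ is positive definite at $\bar\mu$, i.e. $\nabla^rF_{\bar\mu}(Z,\dots,Z)>0$ for all nonzero $Z\in T_{\bar\mu}S^d$. *)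

(* Defs.v *)
From HB Require Import structures.
From mathcomp Require Import all_boot all_order all_algebra.
From mathcomp Require Import ring lra.
From mathcomp Require Import all_classical all_reals all_analysis.

Set Implicit Arguments.
Unset Strict Implicit.
Unset Printing Implicit Defensive.

Import Order.TTheory GRing.Theory Num.Theory.
Import numFieldNormedType.Exports.

Local Open Scope classical_set_scope.
Local Open Scope ring_scope.

(* Borel sigma-algebra *)
HB.instance Definition _ (R : realType) (n : nat) :=
  Measurable.copy 'rV[R]_n (g_sigma_algebraType (open : set (set 'rV[R]_n))).

Section Lebesgue.
Context {R : realType}.

Lemma open_measurable_rV n (A : set 'rV[R]_n) : open A -> measurable A.
Proof. exact: sub_sigma_algebra. Qed.

Lemma measurable_fun_rV d (T : measurableType d) n (f : T -> 'rV[R]_n) :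
  (forall A, open A -> measurable (f @^-1` A)) -> measurable_fun setT f.
Proof.
move=> mf; apply: (measurability (open : set (set 'rV[R]_n))) => //.
by move=> _ [A oA <-]; rewrite setTI; exact: mf.
Qed.

Lemma continuous_measurable_rV n m (f : 'rV[R]_n -> 'rV[R]_m) :
  continuous f -> measurable_fun setT f.
Proof.
move=> cf; apply: measurable_fun_rV => A oA; apply: open_measurable_rV.
by apply: open_comp => // x _; exact: cf.
Qed.

Lemma continuous_measurable_rVR n (f : 'rV[R]_n -> R) :
  continuous f -> measurable_fun setT f.
Proof.
move=> cf; apply: (measurability _ (measurable_realfun.RGenOpens.measurableE R)).
move=> _ [_ [a [b ->] <-]]; rewrite setTI; apply: open_measurable_rV.
by apply: open_comp; [move=> x _; exact: cf|exact: interval_open].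
Qed.

Definition rV_cons n (p : R * 'rV[R]_n) : 'rV[R]_n.+1 := row_mx p.1%:M p.2.

Definition rV_uncons n (v : 'rV[R]_n.+1) : R * 'rV[R]_n :=
  (v 0 0, rsubmx (v : 'rV[R]_(1 + n))).

Lemma rV_cons0 n (p : R * 'rV[R]_n) i (j : 'I_1) :
  rV_cons p i (lshift n j) = p.1.
Proof. by rewrite !ord1; apply: etrans (row_mxEl _ _ _ _) _; rewrite mxE. Qed.

Lemma rV_consS n (p : R * 'rV[R]_n) i (j : 'I_n) :
  rV_cons p i (rshift 1 j) = p.2 i j.
Proof. exact: row_mxEr. Qed.

Lemma rV_consK n : cancel (@rV_cons n) (@rV_uncons n).
Proof.
move=> [x v]; rewrite /rV_uncons; congr pair; last exact: row_mxKr.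
have -> : 0 = lshift n 0 :> 'I_(1 + n) by apply/val_inj.
exact: rV_cons0.
Qed.

Lemma mx_norm_ltP m n (v : 'M[R]_(m, n)) e : 0 < e ->
  (`|v| < e <-> forall i j, `|v i j| < e).
Proof.
move=> e0; split=> [ve i j|ve].
  apply: le_lt_trans ve; rewrite [leRHS]mx_normrE.
  exact: (le_bigmax _ (fun ij => `|v ij.1 ij.2|) (i, j)).
rewrite [ltLHS]mx_normrE; apply/bigmax_ltP; split=> // -[i j] _; exact: ve.
Qed.

Lemma rV_cons_norm_lt n (x : R) (v : 'rV[R]_n) e : 0 < e ->
  `|rV_cons (x, v)| < e <-> `|x| < e /\ `|v| < e.
Proof.
move=> e0; rewrite !mx_norm_ltP //; split=> [h|[hx hv] i j].
  split=> [|i j].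
    by have := h 0 (lshift n 0 : 'I_(1 + n)); rewrite rV_cons0.
  by have := h i (rshift 1 j : 'I_(1 + n)); rewrite rV_consS.
by case: (@split_ordP 1 n j) => k ->; rewrite ?rV_cons0 ?rV_consS.
Qed.

Lemma rV_consB n (x y : R) (v w : 'rV[R]_n) :
  rV_cons (x, v) - rV_cons (y, w) = rV_cons (x - y, v - w).
Proof.
apply/matrixP => i j; rewrite [LHS]mxE [X in _ + X]mxE.
case: (@split_ordP 1 n j) => k ->; first by rewrite !rV_cons0.
by rewrite !rV_consS !mxE.
Qed.

Lemma measurable_rV_cons n : measurable_fun setT (@rV_cons n).
Proof.
apply: measurable_fun_rV => A oA.
pose U (ab : rat * rat) : set 'rV[R]_n :=
  interior [set v | forall x, ratr ab.1 < x < ratr ab.2 -> A (rV_cons (x, v))].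
have -> : @rV_cons n @^-1` A =
    \bigcup_ab (`]ratr ab.1, ratr ab.2[%classic `*` U ab).
  apply/seteqP; split=> [[x v] /= Axv|[x v] [ab _] [/=]]; last first.
    rewrite in_itv /= => xab /interior_subset; exact.
  have /nbhs_ballP[e /= e0 eA] : nbhs (rV_cons (x, v)) A.
    exact/open_nbhs_nbhs.
  have /rat_in_itvoo[a] : x - e < x by rewrite ltrBlDr ltrDl.
  rewrite in_itv /= => /andP[ea ax].
  have /rat_in_itvoo[b] : x < x + e by rewrite ltrDl.
  rewrite in_itv /= => /andP[xb be].
  exists (a, b) => //; split; first by rewrite /= in_itv /= ax.
  apply/nbhs_ballP; exists e => // w vw y /= /andP[ay yb].
  apply: eA; move: vw; rewrite -!ball_normE /= => vw.
  rewrite rV_consB; apply/rV_cons_norm_lt => //; split=> //.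
  by rewrite ltr_norml; apply/andP; split; lra.
apply: countable_bigcupT_measurable => // ab.
apply: measurableX; first exact: measurable_itv.
by apply: open_measurable_rV; exact: open_interior.
Qed.

HB.instance Definition _ n :=
  isMeasurableFun.Build _ _ _ _ (@rV_cons n) (@measurable_rV_cons n).

Lemma measurable_rV_uncons n : measurable_fun setT (@rV_uncons n).
Proof.
apply: measurable_fun_pair.
  by apply: continuous_measurable_rVR => v; exact: coord_continuous.
apply: continuous_measurable_rV => v.
move=> A /nbhs_ballP[e /= e0 eA]; apply/nbhs_ballP; exists e => //= w.
rewrite -ball_normE /= => /mx_norm_ltP-/(_ e0) vw; apply: eA.
rewrite -ball_normE /= -linearB /=.
by apply/mx_norm_ltP => // i j; rewrite mxE; exact: vw.
Qed.

Section lebesgue_rV_cons.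
Variables (n : nat) (m : {sigma_finite_measure set 'rV[R]_n -> \bar R}).

Definition lebesgue_rV_cons : set 'rV[R]_n.+1 -> \bar R :=
  pushforward ((@lebesgue_measure R) \x m)%E (@rV_cons n).

Let lebesgue_rV_cons0 : lebesgue_rV_cons set0 = 0%E.
Proof. by rewrite /lebesgue_rV_cons /pushforward preimage_set0 measure0. Qed.

Let lebesgue_rV_cons_ge0 A : (0 <= lebesgue_rV_cons A)%E.
Proof. by rewrite /lebesgue_rV_cons /pushforward; exact: measure_ge0. Qed.

Let lebesgue_rV_cons_sigma_additive : semi_sigma_additive lebesgue_rV_cons.
Proof.
have := @measurable_rV_cons n => mf.
by refine (@measure_semi_sigma_additive _ _ _ _); exact: mf.
Qed.

HB.instance Definition _ := isMeasure.Build _ _ _ lebesgue_rV_cons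
  lebesgue_rV_cons0 lebesgue_rV_cons_ge0 lebesgue_rV_cons_sigma_additive.

Lemma sigma_finite_lebesgue_rV_cons : sigma_finite setT lebesgue_rV_cons.
Proof.
have /sigma_finiteP[F [FT ndF Foo]] := sigma_finiteT (@lebesgue_measure R).
have /sigma_finiteP[G [GT ndG Goo]] := sigma_finiteT m.
exists (fun k => @rV_uncons n @^-1` (F k `*` G k)).
  apply/seteqP; split=> // v _.
  have [i _ Fi] : (\bigcup_i F i) (v 0 0) by rewrite -FT.
  have [j _ Gj] : (\bigcup_j G j) (rV_uncons v).2 by rewrite -GT.
  exists (maxn i j) => //; split.
    by move: Fi; exact/subsetPset/ndF/leq_maxl.
  by move: Gj; exact/subsetPset/ndG/leq_maxr.
move=> k; have [mF Fk] := Foo k; have [mG Gk] := Goo k; split.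
  rewrite -[X in measurable X]setTI; apply: measurable_rV_uncons => //.
  exact: measurableX.
rewrite /lebesgue_rV_cons /pushforward -comp_preimage.
rewrite (_ : _ \o _ = id); last by apply/funext => p /=; rewrite rV_consK.
by rewrite preimage_id product_measure1E// lte_mul_pinfty// ge0_fin_numE.
Qed.

HB.instance Definition _ := Measure_isSigmaFinite.Build _ _ _
  lebesgue_rV_cons sigma_finite_lebesgue_rV_cons.

End lebesgue_rV_cons.

Fixpoint lebesgue_rV n : {sigma_finite_measure set 'rV[R]_n -> \bar R} :=
  if n is n'.+1 then lebesgue_rV_cons (lebesgue_rV n') else dirac (0 : 'rV[R]_0).

End Lebesgue.

Section Sphere.
Context {R : realType}.

Definition dot n (u v : 'rV[R]_n) : R := (u *m v^T) 0 0.

Definition normalize n (v : 'rV[R]_n) : 'rV[R]_n :=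
  (Num.sqrt (dot v v))^-1 *: v.

Definition sphere d : set 'rV[R]_d.+1 := [set x | dot x x = 1].

Definition gdist n (x y : 'rV[R]_n) : R := acos (dot x y).

Lemma dotE n (u v : 'rV[R]_n) : dot u v = \sum_i u 0 i * v 0 i.
Proof. by rewrite /dot mxE; apply: eq_bigr => i _; rewrite mxE. Qed.

Lemma continuous_dot n : continuous (fun v : 'rV[R]_n => dot v v).
Proof.
rewrite (_ : (fun _ => _) = fun v : 'rV[R]_n => \sum_i v 0 i * v 0 i); last first.
  by apply/funext => v; rewrite dotE.
elim: (index_enum _) => [|i s IH].
  rewrite (_ : (fun _ => _) = cst 0); first exact: cst_continuous.
  by apply/funext => v; rewrite big_nil.
rewrite (_ : (fun _ => _) =
    (fun v : 'rV[R]_n => v 0 i * v 0 i) \+ fun v => \sum_(j <- s) v 0 j * v 0 j).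
  move=> v; apply: continuousD; last exact: IH.
  by apply: (@continuousM R); exact: coord_continuous.
by apply/funext => v; rewrite big_cons.
Qed.

Lemma dot_gt0 n (v : 'rV[R]_n) : v != 0 -> 0 < dot v v.
Proof.
move=> v0; rewrite dotE lt_neqAle sumr_ge0 ?andbT; last first.
  by move=> i _; rewrite -expr2 sqr_ge0.
apply: contra v0; rewrite eq_sym psumr_eq0; last first.
  by move=> i _; rewrite -expr2 sqr_ge0.
move=> /allP h; apply/eqP/rowP => i; rewrite mxE.
by have := h i; rewrite mem_index_enum => /(_ isT); rewrite mulf_eq0 orbb => /eqP.
Qed.

Lemma continuous_normalize n (v : 'rV[R]_n) :
  v != 0 -> {for v, continuous (@normalize n)}.
Proof.
move=> v0.
have cs : {for v, continuous (fun w : 'rV[R]_n => Num.sqrt (dot w w))}.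
  by apply: continuous_comp; [exact: continuous_dot|exact: sqrt_continuous].
have s0 : Num.sqrt (dot v v) != 0 by rewrite gt_eqF// sqrtr_gt0 dot_gt0.
exact: (@cvgZ _ _ _ _ (nbhs_filter v) _ _ _ _ (cvgV s0 cs) (@cvg_id _ _)).
Qed.

Lemma measurable_normalize n : measurable_fun setT (@normalize n).
Proof.
apply: measurable_fun_rV => A oA.
have c0 : closed [set 0 : 'rV[R]_n].
  exact/accessible_closed_set1/hausdorff_accessible/norm_hausdorff.
have -> : @normalize n @^-1` A =
    (~` [set 0] `&` @normalize n @^-1` A) `|`
    ([set 0] `&` @normalize n @^-1` A).
  by rewrite -setIUl setUC setUv setTI.
apply: (@measurableU _ 'rV[R]_n).
  apply: open_measurable_rV; rewrite openE => v [/= /eqP v0 Av].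
  have vA : nbhs v (@normalize n @^-1` A).
    by apply: continuous_normalize => //; exact: open_nbhs_nbhs.
  have v0' : nbhs v (~` [set 0]).
    by apply: open_nbhs_nbhs; split; [exact: closed_openC|apply/eqP].
  exact: filterI.
have [A0|A0] := pselect (A (normalize 0)).
  rewrite (_ : _ `&` _ = [set 0]); last first.
    by apply/seteqP; split=> [v []//|v ->].
  rewrite -[X in measurable X]setCK; apply: (@measurableC _ 'rV[R]_n).
  by apply: open_measurable_rV; exact: closed_openC.
rewrite (_ : _ `&` _ = set0); first exact: measurable0.
by apply/seteqP; split=> // v [-> /A0].
Qed.

Section sphere_volume.
Variable d : nat.

Let punctured_ball : set 'rV[R]_d.+1 := [set x | 0 < dot x x <= 1].

Let measurable_punctured_ball : measurable punctured_ball.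
Proof.
rewrite (_ : punctured_ball =
    setT `&` (fun x => dot x x) @^-1` `]0, 1]%classic); last first.
  by apply/seteqP; split=> [x|x []] /=; rewrite in_itv.
apply: continuous_measurable_rVR => //; exact: continuous_dot.
Qed.

(* The volume element of S^d as the cone measure: A has (d + 1) times the
   Lebesgue measure of the cone {t y | 0 < t <= 1, y in A}, by integration in
   polar coordinates. *)
Definition sphere_volume (A : set 'rV[R]_d.+1) : \bar R :=
  (d.+1%:R%:E * lebesgue_rV d.+1
    (@normalize d.+1 @^-1` A `&` [set x | (0 < dot x x <= 1)%R]))%E.

Let sphere_volume0 : sphere_volume set0 = 0%E.
Proof. by rewrite /sphere_volume preimage_set0 set0I measure0 mule0. Qed.

Let sphere_volume_ge0 A : (0 <= sphere_volume A)%E.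
Proof. by rewrite /sphere_volume mule_ge0. Qed.

Let sphere_volume_sigma_additive : semi_sigma_additive sphere_volume.
Proof.
have mf := @measurable_normalize d.+1.
by refine (@measure_semi_sigma_additive _ _ _ (mscale d.+1%:R%:nng (pushforward
  (mrestr (lebesgue_rV d.+1) measurable_punctured_ball) (@normalize d.+1))));
  exact: mf.
Qed.

HB.instance Definition _ := isMeasure.Build _ _ _ sphere_volume
  sphere_volume0 sphere_volume_ge0 sphere_volume_sigma_additive.

End sphere_volume.

End Sphere.
Arguments sphere R d : clear implicits.
Arguments sphere_volume R d : clear implicits.

Section Frechet.
Context {R : realType} {d : nat}.
Local Notation V := 'rV[R]_d.+1.

Definition frechet (mu : {measure set V -> \bar R}) (x : V) : R :=
  (\int[mu]_(y in sphere R d) (gdist y x ^+ 2 / 2))%R.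

Definition frechet_mean_set (mu : {measure set V -> \bar R}) : set V :=
  [set x | sphere R d x /\ forall z, sphere R d z -> frechet mu x <= frechet mu z].

End Frechet.

Section CovariantDerivative.
Context {R : realType} {d : nat}.
Local Notation V := 'rV[R]_d.+1.

Definition tangent (p : V) : set V := [set v | dot p v = 0].

Definition tproj (p v : V) : V := v - dot p v *: p.

(* Only the values at points of S^d on tangent vectors matter. *)
Definition tensor_field k := V -> k.-tuple V -> R.

(* The vector field on S^d with value v at p when v is tangent at p, extended
   to V \ {0} as a function homogeneous of degree 0. *)
Definition vfield (v : V) : V -> V := fun x => tproj (normalize x) v.

(* The Levi-Civita connection of S^d is the tangential part of the derivative
   in the ambient space. *)
Definition levi_civita (v : V) (X : V -> V) (p : V) : V := tproj p ('D_v X p).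

Definition teval k (T : tensor_field k) (vs : k.-tuple V) : V -> R :=
  fun x => T (normalize x) [tuple vfield (tnth vs i) x | i < k].

(* (nabla T)(X_0, ..., X_k) =
     X_0 (T (X_1, ..., X_k)) - sum_i T (X_1, ..., nabla_(X_0) X_i, ..., X_k),
   computed at p with X_i := vfield v_i. *)
Definition covariant_derivative k (T : tensor_field k) : tensor_field k.+1 :=
  fun p vs =>
    let v0 := thead vs in
    let ws : k.-tuple V := [tuple of behead vs] in
    'D_v0 (teval T ws) p -
    \sum_(i < k) T p
      [tuple if j == i then levi_civita v0 (vfield (tnth ws i)) p
             else tnth ws j | j < k].

Fixpoint nabla r (F : V -> R) : tensor_field r :=
  if r is r'.+1 then covariant_derivative (@nabla r' F) else fun p _ => F p.
Arguments nabla : clear implicits.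

Definition times_differentiable_near r (F : V -> R) (p : V) : Prop :=
  \forall x \near p, sphere R d x ->
    forall k (vs : k.-tuple V), (k < r)%N ->
      differentiable (teval (nabla k F) vs) x.

(* 'D_v is total, so the existence of the derivatives up to order r is required
   explicitly. The order r = 0 is excluded because nabla 0 F = F. *)
Definition smeary (mu : {measure set V -> \bar R}) (m : V) : Prop :=
  (forall v w, tangent m v -> tangent m w ->
     nabla 2 (frechet mu) m [tuple v; w] = 0) /\
  exists r : nat, [/\ (0 < r)%N, ~~ odd r,
    times_differentiable_near r (frechet mu) m &
    forall z, tangent m z -> z != 0 ->
      0 < nabla r (frechet mu) m [tuple z | _ < r]].

End CovariantDerivative.

(* Main.v *)
(* Let F be the Fréchet function and G(c) = acos(c)^2 / 2, so that
   F(x) = int G(<y,x>) dmu(y). Near c = 1 the function G is a power series in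
   1 - c, and (1 - c^2) G'' - c G' = 1. Average F over the points
   cos t m + sin t v, v in S^(d-1), and put k = 1 - cos t. A Taylor expansion,
   uniform on the support of mu because mu vanishes near -m, gives
     mean F - F(m) = k I + k^2 int J dmu + O(t^5),
   where I = int L dmu is the Laplacian of F at m divided by d. The equation of
   G and its derivatives yield J <= a L - 1/16 for d = 2, 3 (in dimension d,
   Delta^2 of half the squared distance r^2/2 is
   (d-1) ((d-3) (1 - r cot r) / sin^2 r - (d-1)) < 0). If the Hessian of F
   vanishes at m then I = 0, and the mean of F over a small geodesic sphere is
   less than F(m), contradicting minimality. Hence the Hessian never vanishes.
   The mean over directions is taken exactly by a finite cubature formula. *)
Require Import Defs.
From mathcomp Require Import all_boot all_order all_algebra.
From mathcomp Require Import ring lra zify.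
From mathcomp Require Import all_classical all_reals all_analysis.
From mathcomp Require Import measurable_realfun.

Set Implicit Arguments.
Unset Strict Implicit.
Unset Printing Implicit Defensive.

Import Order.TTheory GRing.Theory Num.Theory.
Import numFieldNormedType.Exports.

Local Open Scope classical_set_scope.
Local Open Scope ring_scope.

(** * Power series and Taylor bounds *)

Section PowerSeries.
Context {R : realType}.
Implicit Types (a : R^nat) (r x : R).

(** Abel's form of the radius of convergence: bounded terms at each smaller [s]. It passes to
    termwise derivatives with only the bound [M] changing. *)
Definition radius_ge r a := forall s, 0 <= s < r ->
  exists M, forall n, `|a n| * s ^+ n <= M.

(** Comparison with a geometric series of ratio [|x| / s], where [s] is the midpoint of [|x|] and
    [r]. *)
Lemma radius_ge_cvg r a x : radius_ge r a -> `|x| < r -> cvgn (pseries a x).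
Proof.
move=> ra xr; pose s := (`|x| + r) / 2.
have x0 : 0 <= `|x| by [].
have s0 : 0 < s by rewrite /s; lra.
have xs : `|x| < s by rewrite /s; lra.
have [|M aM] := ra s; first by rewrite /s; apply/andP; split; lra.
apply: normed_cvg.
apply: (@series_le_cvg _ _ (geometric M (`|x| / s))) => [n|n|n|].
- exact: normr_ge0.
- apply: geometric_ge0; last exact: divr_ge0 x0 (ltW s0).
  by apply: le_trans (aM 0%N); rewrite mulr_ge0.
- rewrite /geometric /= normrM normrX expr_div_n mulrA ler_pdivlMr ?exprn_gt0//.
  by rewrite mulrAC ler_wpM2r ?exprn_ge0.
- apply: is_cvg_geometric_series.
  by rewrite (ger0_norm (divr_ge0 x0 (ltW s0))) ltr_pdivrMr// mul1r.
Qed.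

(** The factor [n.+1] produced by differentiation is absorbed by passing from [s] to a larger
    [t < r]. *)
Lemma radius_ge_diffs r a : radius_ge r a -> radius_ge r (pseries_diffs a).
Proof.
move=> ra s /andP[s0 sr]; pose t := (s + r) / 2.
have t0 : 0 < t by rewrite /t; lra.
have st : s < t by rewrite /t; lra.
have [|M aM] := ra t; first by rewrite /t; apply/andP; split; lra.
have M0 : 0 <= M by apply: le_trans (aM 0%N); rewrite mulr_ge0.
(* Bernoulli: [n.+1 <= C (t / s) ^ n], written without dividing by [s] *)
have bern n : n.+1%:R * s ^+ n * (t - s) <= t * t ^+ n.
  elim: n => [|n IH]; first by rewrite !expr0; lra.
  rewrite -natr1 !exprS mulrDl mul1r mulrDl.
  have -> : n.+1%:R * (s * s ^+ n) * (t - s) = s * (n.+1%:R * s ^+ n * (t - s)).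
    by ring.
  apply: (@le_trans _ _ (s * (t * t ^+ n) + t * t ^+ n * (t - s))); last first.
    by rewrite le_eqVlt; apply/orP; left; apply/eqP; ring.
  rewrite lerD ?ler_wpM2l// ler_wpM2r ?subr_ge0 ?(ltW st)//.
  by rewrite ler_pM ?exprn_ge0 ?(ltW st)// lerXn2r ?nnegrE ?(ltW t0) ?(ltW st).
exists (M / (t - s)) => n.
rewrite ler_pdivlMr ?subr_gt0// /pseries_diffs normrM normr_nat.
apply: le_trans (aM n.+1); rewrite exprS.
have -> : n.+1%:R * `|a n.+1| * s ^+ n * (t - s) =
          `|a n.+1| * (n.+1%:R * s ^+ n * (t - s)) by ring.
by rewrite ler_wpM2l.
Qed.

Lemma is_derive_pseries r a x : radius_ge r a -> `|x| < r ->
  is_derive x 1 (fun y => limn (pseries a y)) (limn (pseries (pseries_diffs a) x)).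
Proof.
move=> ra xr; pose k := (`|x| + r) / 2.
have x0 : 0 <= `|x| by [].
have k0 : 0 <= k by rewrite /k; lra.
have kr : `|k| < r by rewrite ger0_norm// /k; lra.
have ra1 := radius_ge_diffs ra; have ra2 := radius_ge_diffs ra1.
apply: (pseries_snd_diffs (K := k)); do ?exact: radius_ge_cvg kr.
by rewrite (ger0_norm k0) /k; lra.
Qed.

(** Induction on [n]: the difference with the Taylor polynomial vanishes at [c], the induction
    hypothesis bounds its derivative, and the mean value theorem integrates that bound. The factor 1
    / n! is given up, which keeps the induction simple. *)
Lemma taylor_bound n (g : nat -> R -> R) (l h K c x : R) :
  (forall k y, (k < n)%N -> l < y < h -> is_derive y 1 (g k) (g k.+1 y)) ->
  (forall y, l < y < h -> `|g n y| <= K) -> l < c < h -> l < x < h ->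
  `|g 0%N x - \sum_(k < n) g k c * (x - c) ^+ k / k`!%:R| <= K * `|x - c| ^+ n.
Proof.
elim: n g x => [|n IH] g x dg bg clh xlh.
  by rewrite big_ord0 subr0 expr0 mulr1 bg.
(* The index is shifted by one, with [e 0 = 0], so that [e i] is the derivative of [e i.+1] for
   every [i], constants included; [p 1] is then the derivative of [p 0]. *)
pose e k := if k is k'.+1 then fun y : R =>
    (y - c) ^+ k' / k'`!%:R else fun=> 0 : R.
pose p k (y : R) := \sum_(i < n.+1) g i c * e (i.+1 - k)%N y.
have p0 y : \sum_(k < n.+1) g k c * (y - c) ^+ k / k`!%:R = p 0%N y.
  by apply: eq_bigr => i _; rewrite subn0 /= mulrA.
have p1 y : p 1%N y = \sum_(k < n) g k.+1 c * (y - c) ^+ k / k`!%:R.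
  rewrite /p big_ord_recl /= mulr0 add0r; apply: eq_bigr => i _.
  by rewrite /bump /= !add1n add0n mulrA.
have de i (y : R) : is_derive y 1 (e i.+1) (e i y).
  case: i => [|i] /=.
    rewrite (_ : (fun _ => _) = cst (1 : R)); first exact: is_derive_cst.
    by apply/funext => z; rewrite expr0 divr1.
  rewrite (_ : (fun _ => _) = (i.+1`!%:R)^-1 *: ((id - cst c) ^+ i.+1)); last first.
    by apply/funext => z; rewrite mulrC; congr (_ * _); rewrite fctE.
  apply: is_derive_eq.
  rewrite /e /= subr0 [_ *: _]mulrC -[_ *: _]/(_ * _) factS natrM invfM.
  by rewrite [_ * 1]mulr1 [X in X * _]mulrC mulrA mulfK ?pnatr_eq0.
have dp (y : R) : is_derive y 1 (p 0%N) (p 1%N y).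
  rewrite (_ : p 0%N = \sum_(i < n.+1) g i c *: e i.+1); last first.
    by apply/funext => z; rewrite fct_sumE.
  apply: is_derive_eq; rewrite /p; apply: eq_bigr => i _; rewrite subn1 /=.
  by [].
pose f y := g 0%N y - p 0%N y.
have fc : f c = 0.
  rewrite /f -p0 big_ord_recl expr0 divr1 mulr1 big1 ?addr0 ?subrr// => i _.
  by rewrite expr0n /= mulr0 mul0r.
have df (y : R) : l < y < h -> is_derive y 1 f (g 1%N y - p 1%N y).
  by move=> ylh; apply: is_deriveB; exact: dg.
have bf y : l < y < h -> `|g 1%N y - p 1%N y| <= K * `|y - c| ^+ n.
  move=> ylh; rewrite p1; apply: (IH (fun k => g k.+1)) => // k z kn zlh.
  exact: dg.
have mvt u v : l < u -> u <= v -> v < h ->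
    exists2 z, u <= z <= v & f v - f u = (g 1%N z - p 1%N z) * (v - u).
  move=> lu uv vh; apply: MVT_segment => // [z /itvP zuv|].
    by apply: df; rewrite (lt_le_trans lu) ?zuv// (le_lt_trans _ vh) ?zuv.
  apply: derivable_within_continuous => z; rewrite in_itv /= => /andP[uz zv].
  by apply: ex_derive; apply: df; rewrite (lt_le_trans lu) ?(le_lt_trans zv).
have K0 : 0 <= K by apply: le_trans (bg _ clh).
have : exists2 z, l < z < h /\ `|z - c| <= `|x - c| &
    f x = (g 1%N z - p 1%N z) * (x - c).
  move: clh xlh => /andP[lc ch] /andP[lx xh].
  have [cx|/ltW xc] := leP c x.
    have [//|//|//|z /andP[cz zx] E] := mvt c x; exists z; last by rewrite -E fc subr0.
    by rewrite !ger0_norm ?subr_ge0 ?lerB// (lt_le_trans lc) ?(le_lt_trans zx).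
  have [//|//|//|z /andP[xz zc] E] := mvt x c; exists z.
    rewrite distrC [leRHS]distrC !ger0_norm ?subr_ge0 ?lerB//.
    by rewrite (lt_le_trans lx) ?(le_lt_trans zc).
  by apply: oppr_inj; rewrite -[LHS]add0r -fc E; ring.
move=> [z [zlh zx] E]; rewrite p0 -/(f x) E normrM exprSr mulrA.
rewrite ler_wpM2r// (le_trans (bf _ zlh))// ler_wpM2l//.
by rewrite lerXn2r ?nnegrE.
Qed.

End PowerSeries.

(** * Half the squared arc cosine *)

Section HalfSquaredAcos.
Context {R : realType}.

(* For [n > 0] this is [2 ^+ n / (n ^ 2 * 'C(2 n, n))], the coefficient of
   [u ^+ n] in [acos (1 - u) ^+ 2 / 2]. *)
Fixpoint acos_coef (n : nat) : R :=
  if n is n'.+1 then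
    if n' is 0 then 1 else n'%:R ^+ 2 / (n%:R * (n'.*2.+1)%:R) * acos_coef n'
  else 0.

Lemma acos_coef_ge0 n : 0 <= acos_coef n.
Proof.
elim: n => [//|[|n] IH]; first exact: ler01.
by rewrite /= mulr_ge0// divr_ge0// ?exprn_ge0// mulr_ge0.
Qed.

Lemma acos_coefS n : n.+2%:R * (n.+1.*2.+1)%:R * acos_coef n.+2 =
  n.+1%:R ^+ 2 * acos_coef n.+1.
Proof.
by rewrite [acos_coef n.+2]/= mulrA [X in X * _]mulrC divfK// mulf_neq0.
Qed.

(** From [n = 1] on, [acos_coef n * 2 ^+ n] is nonincreasing, since 2 (n+1)^2 <= (n+2) (2n+3); its
    value at 1 is 2. *)
Lemma radius_acos_coef : radius_ge 2 acos_coef.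
Proof.
move=> s /andP[s0 s2]; exists 2 => n.
rewrite ger0_norm ?acos_coef_ge0//.
apply: (@le_trans _ _ (acos_coef n * 2 ^+ n)).
  by rewrite ler_wpM2l ?acos_coef_ge0// lerXn2r ?nnegrE// ltW.
elim: n => [|[|n] IH]; rewrite ?mul0r ?expr1 ?mul1r//.
apply: le_trans IH; rewrite exprS mulrA ler_wpM2r ?exprn_ge0//.
have p : 0 < n.+2%:R * (n.+1.*2.+1)%:R :> R by rewrite mulr_gt0.
rewrite -(ler_pM2l p) mulrA acos_coefS mulrAC ler_wpM2r ?acos_coef_ge0//.
by rewrite -natrX -!natrM ler_nat; lia.
Qed.

Definition acos_diffs k := iter k (@pseries_diffs R) acos_coef.

Lemma radius_acos_diffs k : radius_ge 2 (acos_diffs k).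
Proof. by elim: k => [|k IH]; [exact: radius_acos_coef|exact: radius_ge_diffs]. Qed.

Lemma acos_diffs_ge0 k n : 0 <= acos_diffs k n.
Proof.
elim: k n => [|k IH] n; first exact: acos_coef_ge0.
by rewrite /acos_diffs iterS /pseries_diffs; apply: mulr_ge0 => //; exact: IH.
Qed.

(* The derivatives of half the squared arc cosine, continued analytically beyond
   its branch point [c = 1]. *)
Definition hsa k (c : R) : R := (-1) ^+ k * limn (pseries (acos_diffs k) (1 - c)).

Lemma is_derive_hsa k (c : R) : `|1 - c| < 2 -> is_derive c 1 (hsa k) (hsa k.+1 c).
Proof.
move=> c2; rewrite /hsa.
have d1 : is_derive c 1 (fun y : R => 1 - y) (-1).
  rewrite (_ : (fun _ => _) = cst 1 - id); last exact/funext.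
  by apply: is_derive_eq; rewrite sub0r.
have d2 := is_derive_pseries (radius_acos_diffs k) c2.
have d3 := is_derive1_comp (g := fun y : R => 1 - y) d2 d1.
rewrite (_ : (fun _ => _) = (-1) ^+ k *: ((fun y : R =>
  limn (pseries (acos_diffs k) y)) \o (fun y : R => 1 - y)))//.
by apply: is_derive_eq; rewrite -[_ *: _]/(_ * _) exprS; ring.
Qed.

(** The equation u (2 - u) y'' + (1 - u) y' = 1 on partial sums: the recurrence of the coefficients
    makes the sum telescope and leaves two boundary terms. *)
Lemma acos_ode_partial (u : R) n (a := acos_diffs 1) (b := acos_diffs 2) :
  u * (2 - u) * series (fun i => b i * u ^+ i) n +
    (1 - u) * series (fun i => a i * u ^+ i) n =
  1 - a n * u ^+ n - n%:R * a n * u ^+ n * u.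
Proof.
have aE i : (i%:R *+ 2 + 3) * a i.+1 = (i%:R + 1) * a i.
  apply: (@mulfI _ (i.+1%:R)); first by rewrite pnatr_eq0.
  have a1 j : a j = (j%:R + 1) * acos_coef j.+1 by rewrite natr1.
  have E : (i%:R + 1 + 1) * (i%:R *+ 2 + 3) * acos_coef i.+2 =
      (i%:R + 1) ^+ 2 * acos_coef i.+1.
    have := acos_coefS i; rewrite !natr1 => <-; congr (_ * _ * _).
    by rewrite -mulr_natr -natrM -natrD; congr (_%:R); lia.
  rewrite !a1 -natr1; move: (acos_coef i.+2) (acos_coef i.+1) E => x y E.
  transitivity ((i%:R + 1) * ((i%:R + 1 + 1) * (i%:R *+ 2 + 3) * x)).
    by ring.
  by rewrite E; ring.
have bE i : b i = (i%:R + 1) * a i.+1 by rewrite natr1.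
have a0 : a 0%N = 1 by rewrite /a /acos_diffs /= /pseries_diffs mulr1.
elim: n => [|n IH].
  by rewrite /series /= !big_nil a0 expr0; ring.
have E : forall f : nat -> R, series f n.+1 = series f n + f n.
  by move=> f; rewrite /series /= big_nat_recr.
rewrite !E; move: (series _ n) (series _ n) IH => T S IH.
transitivity ((u * (2 - u) * S + (1 - u) * T) +
    (u * (2 - u) * (b n * u ^+ n) + (1 - u) * (a n * u ^+ n))); first by ring.
rewrite IH bE exprS -natr1.
apply/eqP; rewrite -subr_eq0; apply/eqP.
transitivity (u * u ^+ n * ((n%:R *+ 2 + 3) * a n.+1 - (n%:R + 1) * a n)).
  by ring.
by rewrite aE subrr mulr0.
Qed.

Lemma limn_acos_ode (u : R) : `|u| < 2 ->
  u * (2 - u) * limn (pseries (acos_diffs 2) u) +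
    (1 - u) * limn (pseries (acos_diffs 1) u) = 1.
Proof.
move=> u2.
have c1 := radius_ge_cvg (radius_acos_diffs 1) u2.
have c2 := radius_ge_cvg (radius_acos_diffs 2) u2.
have L : u * (2 - u) * series (fun i => acos_diffs 2 i * u ^+ i) n +
    (1 - u) * series (fun i => acos_diffs 1 i * u ^+ i) n @[n --> \oo] -->
    u * (2 - u) * limn (pseries (acos_diffs 2) u) +
    (1 - u) * limn (pseries (acos_diffs 1) u).
  by apply: cvgD; apply: cvgMr.
have t1 := cvg_series_cvg_0 c1; have t2 := cvg_series_cvg_0 c2.
(* Taken at index [n.+1], the second boundary term is a multiple of [acos_diffs 2 n * u ^+ n], so
   both are terms of convergent series, up to a constant factor, and tend to 0. *)
have L1 : 1 - acos_diffs 1 n.+1 * u ^+ n.+1 - acos_diffs 2 n * u ^+ n * (u ^+ 2)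
    @[n --> \oo] --> 1 - 0 - 0 * u ^+ 2.
  apply: cvgB; last exact: cvgMl.
  apply: cvgB; first exact: cvg_cst.
  by rewrite (cvg_shiftS (fun n => acos_diffs 1 n * u ^+ n)).
rewrite -(cvg_shiftS (fun n => u * (2 - u) * _ n + _ * _ n)) in L.
rewrite -(cvg_lim (@Rhausdorff R) L).
transitivity (1 - 0 - 0 * u ^+ 2 : R); last by rewrite mul0r !subr0.
apply: cvg_lim => //.
apply: cvg_trans L1; apply: near_eq_cvg; apply: nearW => n.
have -> : acos_diffs 2 n = n.+1%:R * acos_diffs 1 n.+1 by [].
by rewrite [RHS](acos_ode_partial u n.+1) exprS; ring.
Qed.

Lemma hsa_ode1 (c : R) : `|1 - c| < 2 ->
  (1 - c ^+ 2) * hsa 2 c - c * hsa 1 c = 1.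
Proof.
by move=> /limn_acos_ode; rewrite /hsa expr1 => E; rewrite -[RHS]E; ring.
Qed.

Lemma near_hsa_dom (c : R) : `|1 - c| < 2 -> \near c, `|1 - c| < 2.
Proof.
move=> c2; exists (2 - `|1 - c|); first by rewrite /= subr_gt0.
move=> y /= cy; have : `|1 - y| <= `|1 - c| + `|c - y|.
  by have := ler_normD (1 - c) (c - y); rewrite addrA subrK.
by lra.
Qed.

(** [hsa_ode1] holds on an open set, so it may be differentiated; [hsa_ode3] repeats the step. *)
Lemma hsa_ode2 (c : R) : `|1 - c| < 2 ->
  (1 - c ^+ 2) * hsa 3 c = 3 * c * hsa 2 c + hsa 1 c.
Proof.
move=> c2.
have d1 := is_derive_hsa 1 c2; have d2 := is_derive_hsa 2 c2.
have d : is_derive c 1 ((cst 1 - id ^+ 2) * hsa 2 - id * hsa 1)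
   ((1 - c ^+ 2) * hsa 3 c - 3 * c * hsa 2 c - hsa 1 c).
  apply: is_derive_eq; rewrite -![_ *: _]/(_ * _) !fctE /=.
  ring.
have e : is_derive c 1 ((cst 1 - id ^+ 2) * hsa 2 - id * hsa 1) 0.
  apply: near_eq_is_derive (is_derive_cst (1 : R) c 1).
  by near=> y; rewrite !fctE hsa_ode1//; near: y; exact: near_hsa_dom.
have := @derive_val _ _ _ _ _ _ _ d; rewrite (@derive_val _ _ _ _ _ _ _ e); lra.
Unshelve. all: by end_near. Qed.

Lemma hsa_ode3 (c : R) : `|1 - c| < 2 ->
  (1 - c ^+ 2) * hsa 4 c = 5 * c * hsa 3 c + 4 * hsa 2 c.
Proof.
move=> c2.
have d1 := is_derive_hsa 1 c2; have d2 := is_derive_hsa 2 c2.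
have d3 := is_derive_hsa 3 c2.
have d : is_derive c 1 ((cst 1 - id ^+ 2) * hsa 3 - (cst 3 * id * hsa 2 + hsa 1))
   ((1 - c ^+ 2) * hsa 4 c - 5 * c * hsa 3 c - 4 * hsa 2 c).
  apply: is_derive_eq; rewrite -![_ *: _]/(_ * _) !fctE /=.
  ring.
have e : is_derive c 1 ((cst 1 - id ^+ 2) * hsa 3 - (cst 3 * id * hsa 2 + hsa 1)) 0.
  apply: near_eq_is_derive (is_derive_cst (0 : R) c 1).
  by near=> y; rewrite !fctE hsa_ode2 ?subrr//; near: y; exact: near_hsa_dom.
have := @derive_val _ _ _ _ _ _ _ d; rewrite (@derive_val _ _ _ _ _ _ _ e); lra.
Unshelve. all: by end_near. Qed.

(** The coefficients and the variable [1 - c] of the series are nonnegative. This fixes the sign of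
    the leftover term in [mean_quartic2]. *)
Lemma hsa2_ge0 (c : R) : `|1 - c| < 2 -> c <= 1 -> 0 <= hsa 2 c.
Proof.
move=> c2 c1; rewrite /hsa -signr_odd expr0 mul1r.
apply: limr_ge; first exact: radius_ge_cvg (radius_acos_diffs 2) c2.
apply: nearW => n; rewrite /pseries /series /=; apply: sumr_ge0 => i _.
by apply: mulr_ge0; [exact: (acos_diffs_ge0 2 i)|rewrite exprn_ge0// subr_ge0].
Qed.

Lemma hsa0_1 : hsa 0 1 = 0.
Proof.
rewrite /hsa expr0 mul1r subrr; apply/cvg_lim => //.
apply: cvg_near_cst; apply: nearW => n; rewrite /pseries /series /=.
by apply: big1 => -[|i] _; rewrite ?mul0r// expr0n mulr0.
Qed.

(** Substitute [c = cos t] and compare second derivatives in [t]. Working on []- pi, pi[] makes the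
    base point 0 interior. *)
Lemma hsaE (c : R) : -1 < c <= 1 -> hsa 0 c = acos c ^+ 2 / 2.
Proof.
move=> /andP[c1 c2].
have cc : -1 <= c <= 1 by rewrite (ltW c1).
pose t := acos c.
have t0 : 0 <= t by exact: acos_ge0.
have tpi : t < pi by apply: acos_ltpi; rewrite c1.
have cosd (x : R) : - pi < x < pi -> `|1 - cos x| < 2.
  move=> /andP[x1 x2].
  have : -1 < cos x :> R.
    have pp : pi \in `[0, pi : R] by rewrite in_itv/= pi_ge0 lexx.
    rewrite -cospi; have [x0|/ltW x0] := leP 0 x.
      by rewrite ltr_cos// in_itv/= x0 ltW.
    rewrite -[cos x]cosN ltr_cos//; first by rewrite ltrNl.
    by rewrite in_itv/= oppr_ge0 x0 lerNl ltW.
  by rewrite ger0_norm ?subr_ge0 ?cos_le1//; lra.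
(* By [hsa_ode1], [hsa 0 (cos x) - x ^+ 2 / 2] has zero second derivative. *)
pose g k : R -> R := match k with
  | 0 => hsa 0 \o cos - (fun x => x ^+ 2 / 2)
  | 1 => - (sin * (hsa 1 \o cos)) - id
  | _ => cst 0 end.
have dg k y : (k < 2)%N -> - pi < y < pi -> is_derive y 1 (g k) (g k.+1 y).
  move=> k2 /cosd cy.
  have dc : is_derive y 1 (@cos R) (- sin y) by exact: is_derive_cos.
  case: k k2 => [|[|//]] _ /=.
    have d0 := is_derive1_comp (is_derive_hsa 0 cy) dc.
    rewrite (_ : (fun x : R => x ^+ 2 / 2) = 2^-1 *: id ^+ 2); last first.
      by apply/funext => z; rewrite mulrC; congr (_ * _); rewrite fctE.
    apply: is_derive_eq; rewrite -![_ *: _]/(_ * _) !fctE /=; by field.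
  have d0 := is_derive1_comp (is_derive_hsa 1 cy) dc.
  apply: is_derive_eq; rewrite -![_ *: _]/(_ * _) !fctE /=.
  by have := hsa_ode1 cy; rewrite -sin2cos2; lra.
have pp : 0 < pi :> R := pi_gt0 R.
(* The value and the first derivative vanish at 0 and the remainder bound is [K = 0], so the
   difference vanishes at [t]. *)
have := @taylor_bound R 2 g (- pi) pi 0 0 t dg.
move=> /(_ _ _ _)/=; rewrite /g mul0r !big_ord_recl big_ord0 /=.
rewrite !fctE /= cos0 sin0 hsa0_1 normr_le0 acosK ?in_itv//=.
move=> H; apply/eqP; rewrite -subr_eq0; move: H.
rewrite -/t !expr0 !(mul0r, mulr0, oppr0, subr0, addr0, expr0n, divr1) /=.
rewrite ?(mul0r, mulr0, oppr0, subr0, addr0) => H; rewrite -normr_le0; apply: H.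
- by [].
- by apply/andP; split; lra.
- by apply/andP; split; lra.
Qed.

End HalfSquaredAcos.

(** * Mean over directions of the squared distance *)

Section Expansion.
Context {R : realType}.

Lemma hsa_bounded (l h : R) n : -1 < l -> l < h -> h < 3 ->
  exists2 B, 0 <= B & forall k c, (k < n)%N -> l <= c <= h -> `|hsa k c| <= B.
Proof.
move=> l1 lh h3; elim: n => [|n [B B0 IH]]; first by exists 0.
have dom c : l <= c <= h -> `|1 - c| < 2.
  by move=> /andP[lc ch]; rewrite ltr_norml; apply/andP; split; lra.
have [//||x xlh xmax] := @EVT_max R (fun c => `|hsa n c|) l h; first exact: ltW.
  move=> x; apply: continuous_comp; last exact: norm_continuous.
  apply: derivable_within_continuous => y; rewrite in_itv /= => /dom y2.
  by apply: ex_derive; exact: is_derive_hsa.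
exists (Num.max B `|hsa n x|); first by rewrite le_max B0.
move=> k c; rewrite ltnS leq_eqVlt => /orP[/eqP -> clh|kn clh].
  by rewrite le_max xmax ?orbT// in_itv.
by rewrite le_max IH.
Qed.

(* For a unit vector [y] with [dot y m = c], [mean_lap], [mean_quartic] and
   [mean_rest] are the coefficients of [k], [k ^+ 2] and [k ^+ 3] (up to the
   Taylor remainder), where [k = 1 - cos t], in the mean of
   [hsa 0 (dot y (cos t *: m + sin t *: v))] over the unit tangent vectors [v]
   at [m]; [n] is the dimension and [gj] stands for [hsa j c]. In particular
   [mean_lap] is the Laplacian at [m] of half the squared distance to [y],
   divided by [n]. *)
Definition mean_lap (n c g1 : R) := (1 - (n - 1) * c * g1) / n.

Definition mean_quartic (n c g2 g3 g4 : R) (s2 := 1 - c ^+ 2) :=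
  g2 / 2 * (c ^+ 2 - s2 / n) - g3 * c * s2 / n + g4 * s2 ^+ 2 / (2 * n * (n + 2)).

(** The three equations eliminate [g3] and [g4], and the first one also turns [c ^+ 2 * g2] into
    [g2 - 1 - c * g1]. What remains is affine in [g2] and [c * g1]. *)
Lemma mean_quartic2 (c g1 g2 g3 g4 : R) (s2 := 1 - c ^+ 2) :
  s2 * g2 - c * g1 = 1 -> s2 * g3 = 3 * c * g2 + g1 ->
  s2 * g4 = 5 * c * g3 + 4 * g2 ->
  mean_quartic 2 c g2 g3 g4 = - (1 / 16) + mean_lap 2 c g1 / 4 - g2 / 16.
Proof.
move=> E1 E2 E3; rewrite /mean_quartic -/s2 /mean_lap.
have E4 : g4 * s2 ^+ 2 = 5 * c * (3 * c * g2 + g1) + 4 * (s2 * g2).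
  rewrite -E2 (_ : g4 * _ = s2 * (s2 * g4)); last by ring.
  by rewrite E3; ring.
have E5 : g3 * c * s2 = c * (3 * c * g2 + g1) by rewrite -E2; ring.
have E6 : s2 * g2 = 1 + c * g1 by rewrite -E1; ring.
have E7 : c ^+ 2 * g2 = g2 - 1 - c * g1.
  by rewrite -addrA -opprD -E6 /s2; ring.
rewrite E4 E5 E6.
have -> : g2 / 2 * (c ^+ 2 - s2 / 2) = c ^+ 2 * g2 / 2 - s2 * g2 / 4 by field.
have -> : 5 * c * (3 * c * g2 + g1) = 15 * (c ^+ 2 * g2) + 5 * (c * g1) by ring.
have -> : c * (3 * c * g2 + g1) = 3 * (c ^+ 2 * g2) + c * g1 by ring.
by rewrite E7 E6; field.
Qed.

(** Same elimination; in dimension 3 the terms in [g2] cancel altogether. *)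
Lemma mean_quartic3 (c g1 g2 g3 g4 : R) (s2 := 1 - c ^+ 2) :
  s2 * g2 - c * g1 = 1 -> s2 * g3 = 3 * c * g2 + g1 ->
  s2 * g4 = 5 * c * g3 + 4 * g2 ->
  mean_quartic 3 c g2 g3 g4 = - (2 / 15) + mean_lap 3 c g1 * (3 / 10).
Proof.
move=> E1 E2 E3; rewrite /mean_quartic -/s2 /mean_lap.
have E4 : g4 * s2 ^+ 2 = 5 * c * (3 * c * g2 + g1) + 4 * (s2 * g2).
  rewrite -E2 (_ : g4 * _ = s2 * (s2 * g4)); last by ring.
  by rewrite E3; ring.
have E5 : g3 * c * s2 = c * (3 * c * g2 + g1) by rewrite -E2; ring.
have E6 : s2 * g2 = 1 + c * g1 by rewrite -E1; ring.
have E7 : c ^+ 2 * g2 = g2 - 1 - c * g1.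
  by rewrite -addrA -opprD -E6 /s2; ring.
rewrite E4 E5 E6.
have -> : g2 / 2 * (c ^+ 2 - s2 / 3) = c ^+ 2 * g2 / 2 - s2 * g2 / 6 by field.
have -> : 5 * c * (3 * c * g2 + g1) = 15 * (c ^+ 2 * g2) + 5 * (c * g1) by ring.
have -> : c * (3 * c * g2 + g1) = 3 * (c ^+ 2 * g2) + c * g1 by ring.
by rewrite E7 E6; field.
Qed.

Definition mean_rest (n c k g3 g4 : R) (s2 := 1 - c ^+ 2) :=
  g3 / 6 * (3 * c * s2 / n - c ^+ 3) +
  g4 / 24 * (k * c ^+ 4 + 12 * c ^+ 2 * s2 / n - 6 * k * c ^+ 2 * s2 / n +
             3 * (k - 4) * s2 ^+ 2 / (n * (n + 2))).

(** The increment of [c] is [- k * c + s * b i], and the hypotheses give the moments of [b] up to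
    order 4. Odd moments vanish, and even powers of [s] are polynomials in [k]. *)
Lemma mean_taylor (I : Type) (r : seq I) (w b : I -> R)
    (n c k s : R) (g : nat -> R) (s2 := 1 - c ^+ 2) :
  0 < n -> s ^+ 2 = 2 * k - k ^+ 2 ->
  s2 * g 2%N - c * g 1%N = 1 ->
  \sum_(i <- r) w i = 1 -> \sum_(i <- r) w i * b i = 0 ->
  \sum_(i <- r) w i * b i ^+ 2 = s2 / n -> \sum_(i <- r) w i * b i ^+ 3 = 0 ->
  \sum_(i <- r) w i * b i ^+ 4 = 3 * s2 ^+ 2 / (n * (n + 2)) ->
  \sum_(i <- r) w i * \sum_(j < 5) g j * (- k * c + s * b i) ^+ j / j`!%:R =
  g 0%N + k * mean_lap n c (g 1%N) + k ^+ 2 * mean_quartic n c (g 2%N) (g 3%N) (g 4%N) +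
  k ^+ 3 * mean_rest n c k (g 3%N) (g 4%N).
Proof.
move=> n0 sk ode w0 w1 w2 w3 w4.
pose x := - k * c.
(* [C0] to [C4] collect the coefficients of the powers of [b i]. *)
pose C0 := g 0%N + g 1%N * x + g 2%N / 2 * x ^+ 2 + g 3%N / 6 * x ^+ 3 +
  g 4%N / 24 * x ^+ 4.
pose C1 := s * (g 1%N + g 2%N * x + g 3%N / 2 * x ^+ 2 + g 4%N / 6 * x ^+ 3).
pose C2 := s ^+ 2 * (g 2%N / 2 + g 3%N / 2 * x + g 4%N / 4 * x ^+ 2).
pose C3 := s ^+ 3 * (g 3%N / 6 + g 4%N / 6 * x).
pose C4 := (s ^+ 2) ^+ 2 * (g 4%N / 24).
have E i : w i * \sum_(j < 5) g j * (- k * c + s * b i) ^+ j / j`!%:R =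
    C0 * w i + C1 * (w i * b i) + C2 * (w i * b i ^+ 2) + C3 * (w i * b i ^+ 3)
    + C4 * (w i * b i ^+ 4).
  rewrite !big_ord_recl big_ord0 /= /bump /= -/x /C0 /C1 /C2 /C3 /C4.
  rewrite (_ : 0`! = 1)%N// (_ : 1`! = 1)%N// (_ : 2`! = 2)%N// (_ : 3`! = 6)%N//.
  by rewrite (_ : 4`! = 24)%N//; field.
under eq_bigr do rewrite E.
rewrite !big_split /= -!mulr_sumr w0 w1 w2 w3 w4.
rewrite /C0 /C2 /C4 sk /mean_lap /mean_quartic /mean_rest -/s2 /x.
(* The coefficient of [k] comes out as [g 2 * s2 / n - c * g 1]; the equation turns it into
   [mean_lap]. *)
have G2 : g 2%N * s2 = 1 + c * g 1%N by rewrite -ode; ring.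
have -> : (1 - (n - 1) * c * g 1%N) / n = g 2%N * s2 / n - c * g 1%N.
  by rewrite G2; field; rewrite gt_eqF.
by field; rewrite !gt_eqF// addr_gt0.
Qed.

(** [(n + 3) / 20] interpolates the factors 1/4 and 3/10 of the two dimensions, and 1/16 is the
    smaller of the constants 1/16 and 2/15. *)
Lemma mean_quartic_le (n c : R) : n = 2 \/ n = 3 -> `|1 - c| < 2 -> c <= 1 ->
  mean_quartic n c (hsa 2 c) (hsa 3 c) (hsa 4 c) <=
  - (1 / 16) + (n + 3) / 20 * mean_lap n c (hsa 1 c).
Proof.
move=> n23 c2 c1; have := hsa2_ge0 c2 c1.
have E1 := hsa_ode1 c2; have E2 := hsa_ode2 c2; have E3 := hsa_ode3 c2.
case: n23 => ->; first by rewrite (mean_quartic2 E1 E2 E3); lra.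
by rewrite (mean_quartic3 E1 E2 E3); lra.
Qed.

(** Each expression is a sum of three products of some [gj] with a factor of absolute value at most
    1. *)
Lemma mean_coef_bounds (n c k g2 g3 g4 B : R) : 1 <= n -> -1 <= c <= 1 ->
  0 <= k <= 1 -> `|g2| <= B -> `|g3| <= B -> `|g4| <= B ->
  `|mean_quartic n c g2 g3 g4| <= 3 * B /\ `|mean_rest n c k g3 g4| <= 3 * B.
Proof.
move=> n1 /andP[c1 c2] /andP[k0 k1] b2 b3 b4.
have B0 : 0 <= B by apply: le_trans b2.
have n0 : 0 < n by apply: lt_le_trans n1.
have sq : 0 <= c ^+ 2 <= 1 by rewrite sqr_ge0 expr2; nra.
pose s2 := 1 - c ^+ 2.
pose p := s2 / n; pose q := s2 ^+ 2 / (n * (n + 2)).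
have s01 : 0 <= s2 <= 1 by rewrite /s2; lra.
have p01 : 0 <= p <= 1.
  rewrite /p divr_ge0 ?(ltW n0)//=; last by lra.
  by rewrite ler_pdivrMr// mul1r; lra.
have q01 : 0 <= q <= 1.
  have nn : 0 < n * (n + 2) by rewrite mulr_gt0// addr_gt0.
  rewrite /q divr_ge0 ?sqr_ge0 ?(ltW nn)//= ler_pdivrMr// mul1r expr2; nra.
have mulB (x y : R) : `|x| <= B -> `|y| <= 1 -> `|x * y| <= B.
  by move=> xB y1; rewrite normrM -[B]mulr1 ler_pM.
have tri (x y z X Y Z : R) : `|x| <= X -> `|y| <= Y -> `|z| <= Z ->
    `|x + y + z| <= X + Y + Z.
  move=> hx hy hz; rewrite (le_trans (ler_normD _ _))// lerD//.
  by rewrite (le_trans (ler_normD _ _))// lerD.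
have unit (x : R) : -1 <= x <= 1 -> `|x| <= 1 by rewrite ler_norml.
split.
  have -> : mean_quartic n c g2 g3 g4 = g2 * ((c ^+ 2 - p) / 2) +
      g3 * (- c * p) + g4 * (q / 2).
    by rewrite /mean_quartic /p /q -/s2; field; rewrite !gt_eqF// addr_gt0.
  have -> : 3 * B = B + B + B by ring.
  by apply: tri; apply: mulB => //; apply: unit; nra.
have -> : mean_rest n c k g3 g4 = g3 * ((3 * c * p - c ^+ 3) / 6) +
    g4 * ((k * (c ^+ 2) ^+ 2 + 12 * c ^+ 2 * p) / 24) +
    g4 * ((- 2 * k * c ^+ 2 * p + (k - 4) * q) / 8).
  by rewrite /mean_rest /p /q -/s2; field; rewrite !gt_eqF// addr_gt0.
have -> : 3 * B = B + B + B by ring.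
have cp : -1 <= c * p <= 1 by nra.
have c3 : -1 <= c ^+ 3 <= 1 by rewrite exprS; nra.
have c4 : 0 <= (c ^+ 2) ^+ 2 <= 1 by rewrite sqr_ge0 expr2; nra.
have c2p : 0 <= c ^+ 2 * p <= 1 by nra.
have kc : 0 <= k * (c ^+ 2) ^+ 2 <= 1 by nra.
have kcp : 0 <= k * (c ^+ 2 * p) <= 1 by nra.
have kq : 0 <= k * q <= 1 by nra.
apply: tri; apply: mulB => //; apply: unit; move: cp c3 c4 c2p kc kcp kq.
- by rewrite -!mulrA; lra.
- by rewrite -!mulrA; lra.
- by rewrite mulrBl -!mulrA; lra.
Qed.

(** The constant [C] depends on [n] and [e] alone, so the expansion can later be integrated over all
    points at a fixed distance from the antipode. *)
Lemma mean_expansion (n e : R) : n = 2 \/ n = 3 -> 0 < e ->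
  exists2 C, 0 <= C & forall (I : Type) (r : seq I) (w b : I -> R) (c k s : R),
  -1 + e <= c <= 1 -> 0 <= k <= 1 -> 0 <= s -> s ^+ 2 = 2 * k - k ^+ 2 ->
  (forall i, -1 + e <= (1 - k) * c + s * b i <= 1) -> (forall i, `|b i| <= 1) ->
  (forall i, 0 <= w i) ->
  \sum_(i <- r) w i = 1 -> \sum_(i <- r) w i * b i = 0 ->
  \sum_(i <- r) w i * b i ^+ 2 = (1 - c ^+ 2) / n ->
  \sum_(i <- r) w i * b i ^+ 3 = 0 ->
  \sum_(i <- r) w i * b i ^+ 4 = 3 * (1 - c ^+ 2) ^+ 2 / (n * (n + 2)) ->
  let L := mean_lap n c (hsa 1 c) in
  let J := mean_quartic n c (hsa 2 c) (hsa 3 c) (hsa 4 c) in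
  `|\sum_(i <- r) w i * hsa 0 ((1 - k) * c + s * b i) - hsa 0 c - k * L - k ^+ 2 * J|
    <= C * s ^+ 5 /\ `|J| <= C.
Proof.
(* [l] lies strictly between -1 and [-1 + e], as the open interval of [taylor_bound] requires; the
   cap 1/2 keeps [l < 2] for large [e]. *)
move=> n23 e0; pose l := -1 + Num.min (e / 2) (1 / 2).
have m0 : 0 < Num.min (e / 2) (1 / 2) :> R by rewrite lt_min !divr_gt0.
have m1 : Num.min (e / 2) (1 / 2) <= 1 / 2 :> R by rewrite ge_min lexx orbT.
have m2 : Num.min (e / 2) (1 / 2) <= e / 2 :> R by rewrite ge_min lexx.
have l1 : -1 < l by rewrite /l; lra.
have le : l < -1 + e by rewrite /l; lra.
have l2 : l < 2 by rewrite /l; lra.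
have [|B B0 hB] := hsa_bounded 6 l1 l2; first by lra.
(* 35 = 2^5 + 3: the Taylor remainder has increments at most [2 * s], and [mean_rest], bounded by
   [3 * B], comes with [k ^+ 3 <= s ^+ 5]. *)
exists (35 * B) => [|I r w b c k s /andP[c1 c2] /andP[k0 k1] s0 sk D b1 w0].
  by rewrite mulr_ge0.
move=> W0 W1 W2 W3 W4 L J.
have cB j : (j < 6)%N -> `|hsa j c| <= B.
  by move=> j6; apply: hB => //; apply/andP; split; lra.
have dom y : l <= y <= 2 -> `|1 - y| < 2.
  by move=> /andP[ly y2]; rewrite ltr_norml; apply/andP; split; lra.
have n1 : 1 <= n by case: n23 => ->; lra.
have n0 : 0 < n by apply: lt_le_trans n1.
have c12 : -1 <= c <= 1 by apply/andP; split; lra.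
have k01 : 0 <= k <= 1 by apply/andP.
have [JB QB] := mean_coef_bounds n1 c12 k01 (cB 2%N isT) (cB 3%N isT) (cB 4%N isT).
split; last by apply: le_trans JB _; rewrite ler_wpM2r//; lra.
have ode : (1 - c ^+ 2) * hsa 2 c - c * hsa 1 c = 1.
  by apply: hsa_ode1; apply: dom; apply/andP; split; lra.
have T := mean_taylor (g := fun j => hsa j c) n0 sk ode W0 W1 W2 W3 W4.
have ks2 : k <= s ^+ 2 by rewrite sk; nra.
have s1 : s <= 1 by rewrite -(@ler_pXn2r _ 2)// ?nnegrE// expr1n sk; nra.
have ks : k <= s by apply: le_trans ks2 _; rewrite expr2; nra.
have k3 : k ^+ 3 <= s ^+ 5.
  apply: (@le_trans _ _ ((s ^+ 2) ^+ 3)); first by rewrite lerXn2r ?nnegrE ?sqr_ge0.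
  have -> : (s ^+ 2) ^+ 3 = s ^+ 5 * s by ring.
  by rewrite ler_piMr ?exprn_ge0.
have S (i : I) :
    `|w i * hsa 0 ((1 - k) * c + s * b i) -
    w i * \sum_(j < 5) hsa j c * (- k * c + s * b i) ^+ j / j`!%:R| <=
    w i * (32 * B * s ^+ 5).
  rewrite -mulrBr normrM ger0_norm// ler_wpM2l//.
  have -> : - k * c + s * b i = (1 - k) * c + s * b i - c by ring.
  have := @taylor_bound R 5 hsa l 2 B c ((1 - k) * c + s * b i).
  move=> /(_ _ _ _ _)/le_trans; apply.
  - by move=> j y _ /andP[ly y2]; apply/is_derive_hsa/dom; rewrite !ltW.
  - by move=> y /andP[ly y2]; apply: hB => //; rewrite !ltW.
  - by apply/andP; split; lra.
  - by have /andP[? ?] := D i; apply/andP; split; lra.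
  rewrite [32 * B]mulrC -mulrA ler_wpM2l//.
  have -> : 32 * s ^+ 5 = (2 * s) ^+ 5 by ring.
  rewrite lerXn2r ?nnegrE ?mulr_ge0//.
  have -> : (1 - k) * c + s * b i - c = - k * c + s * b i by ring.
  rewrite (le_trans (ler_normD _ _))// mulr_natl mulr2n !normrM normrN.
  rewrite (ger0_norm k0) (ger0_norm s0) lerD//; last by rewrite ler_piMr.
  by rewrite (le_trans _ ks)// ler_piMr// ler_norml; apply/andP; split; lra.
have {}S : `|\sum_(i <- r) w i * hsa 0 ((1 - k) * c + s * b i) -
    \sum_(i <- r) w i * \sum_(j < 5) hsa j c * (- k * c + s * b i) ^+ j / j`!%:R| <=
    32 * B * s ^+ 5.
  rewrite -sumrB (le_trans (ler_norm_sum _ _ _))//.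
  by rewrite (le_trans (ler_sum _ (fun i _ => S i)))// -mulr_suml W0 mul1r.
rewrite T -/L -/J in S.
set X := \sum_(i <- r) _ in S *.
have -> : X - hsa 0 c - k * L - k ^+ 2 * J =
   X - (hsa 0 c + k * L + k ^+ 2 * J + k ^+ 3 * mean_rest n c k (hsa 3 c) (hsa 4 c))
   + k ^+ 3 * mean_rest n c k (hsa 3 c) (hsa 4 c) by ring.
rewrite (le_trans (ler_normD _ _))//.
have -> : 35 * B * s ^+ 5 = 32 * B * s ^+ 5 + s ^+ 5 * (3 * B) by ring.
rewrite lerD// normrM ler_pM// ger0_norm// exprn_ge0//.
Qed.

End Expansion.

(** * Orthonormal frames and cubature *)

Section Designs.
Context {R : realType}.

Section dot.
Variable n : nat.
Implicit Types u v w : 'rV[R]_n.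

Lemma dotC u v : dot u v = dot v u.
Proof. by rewrite !dotE; apply: eq_bigr => i _; rewrite mulrC. Qed.

Lemma dotDr u v w : dot u (v + w) = dot u v + dot u w.
Proof. by rewrite !dotE -big_split; apply: eq_bigr => i _; rewrite mxE mulrDr. Qed.

Lemma dotZr u a v : dot u (a *: v) = a * dot u v.
Proof. by rewrite !dotE mulr_sumr; apply: eq_bigr => i _; rewrite mxE mulrCA. Qed.

Lemma dotNr u v : dot u (- v) = - dot u v.
Proof. by rewrite -scaleN1r dotZr mulN1r. Qed.

Lemma dotDl u v w : dot (v + w) u = dot v u + dot w u.
Proof. by rewrite !(dotC _ u) dotDr. Qed.

Lemma dotZl u a v : dot (a *: v) u = a * dot v u.
Proof. by rewrite !(dotC _ u) dotZr. Qed.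

Lemma dotNl u v : dot (- v) u = - dot v u.
Proof. by rewrite !(dotC _ u) dotNr. Qed.

Lemma dot_ge0 u : 0 <= dot u u.
Proof. by rewrite dotE sumr_ge0// => i _; rewrite -expr2 sqr_ge0. Qed.

Lemma dot_unit_le1 u v : dot u u = 1 -> dot v v = 1 -> `|dot u v| <= 1.
Proof.
move=> u1 v1; rewrite ler_norml.
have := dot_ge0 (u + v); have := dot_ge0 (u - v).
rewrite !(dotDl, dotDr, dotNl, dotNr) u1 v1 (dotC v u); lra.
Qed.

End dot.

Definition dot_linear := (dotDl, dotDr, dotNl, dotNr, dotZl, dotZr).

(** The Householder reflection along [u = e - m] exchanges the first basis vector [e] and [m]; for
    [u = 0] the identity serves. *)
Lemma orthogonal_extension n (m : 'rV[R]_n.+1) : dot m m = 1 ->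
  exists2 A : 'M[R]_n.+1, A *m A^T = 1%:M & row 0 A = m.
Proof.
move=> m1; pose e : 'rV[R]_n.+1 := delta_mx 0 0; pose u := e - m.
have e1 : dot e e = 1 by rewrite /dot trmx_delta mul_delta_mx mxE !eqxx.
have row1 : row 0 (1%:M : 'M[R]_n.+1) = e by rewrite rowE mulmx1.
have [/eqP|u0] := eqVneq u 0.
  by rewrite subr_eq0 => /eqP <-; exists 1%:M; rewrite ?trmx1 ?mulmx1.
pose q := dot u u; have q0 : 0 < q by exact: dot_gt0.
have qE : q = 2 * dot e u.
  by rewrite /q /u !(dotDl, dotDr, dotNl, dotNr) e1 m1 (dotC m e); lra.
have uu : u *m u^T = q%:M by rewrite [LHS]mx11_scalar.
pose B := u^T *m u.
have BB : B *m B = q *: B.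
  by rewrite /B mulmxA -(mulmxA u^T) uu mul_mx_scalar -scalemxAl.
have BT i j : B i j = B j i
  by rewrite !mxE; apply: eq_bigr => k _; rewrite !mxE mulrC.
have eB : e *m B = dot e u *: u.
  by rewrite /B mulmxA [e *m u^T]mx11_scalar mul_scalar_mx.
clearbody B; exists (1%:M - (2 / q) *: B).
  have -> : (1%:M - (2 / q) *: B)^T = 1%:M - (2 / q) *: B.
    by apply/matrixP => i j; rewrite !mxE eq_sym BT.
  rewrite mulmxBl !mulmxBr !mul1mx mulmx1 -!scalemxAl -!scalemxAr BB !scalerA.
  have -> : 2 / q * (2 / q) * q = 2 / q + 2 / q by field; rewrite gt_eqF.
  by apply/matrixP => i j; rewrite !mxE; ring.
rewrite rowE -/e mulmxBr mulmx1 -scalemxAr eB scalerA.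
have -> : 2 / q * dot e u = 1 by rewrite mulrAC -qE divff ?gt_eqF.
by rewrite scale1r opprB addrC subrK.
Qed.

(** The frame consists of the other rows of an orthogonal matrix with first row [m]; the last clause
    is Parseval's identity. *)
Lemma orthonormal_frame n (m : 'rV[R]_n.+1) : dot m m = 1 ->
  exists e : 'I_n -> 'rV[R]_n.+1,
  [/\ forall i, dot m (e i) = 0, forall i j, dot (e i) (e j) = (i == j)%:R &
    forall y, \sum_i dot y (e i) ^+ 2 = dot y y - dot y m ^+ 2].
Proof.
move=> m1; have [A AA Am] := orthogonal_extension m1.
have rowD i j : dot (row i A) (row j A) = (i == j)%:R.
  transitivity ((A *m A^T) i j); last by rewrite AA mxE.
  by rewrite dotE mxE; apply: eq_bigr => k _; rewrite !mxE.
exists (fun i => row (lift ord0 i) A); split=> [i|i j|y].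
- by rewrite -Am rowD.
- by rewrite rowD (inj_eq (@lift_inj _ _)).
have yA i : (y *m A^T) 0 i = dot y (row i A).
  by rewrite dotE mxE; apply: eq_bigr => k _; rewrite !mxE.
have <- : dot (y *m A^T) (y *m A^T) = dot y y.
  rewrite /dot trmx_mul trmxK mulmxA -(mulmxA y).
  by rewrite (mulmx1C AA) mulmx1.
rewrite [dot (_ *m _) _]dotE big_ord_recl !yA Am -expr2 [X in _ = X - _]addrC addrK.
by apply: eq_bigr => i _; rewrite yA expr2.
Qed.

(* Spherical cubature formulas of degree 5, exact for the uniform probability
   measure on the unit circle and on the unit sphere. *)
Lemma tangent_design d (m : 'rV[R]_d.+1) : d = 2%N \/ d = 3%N -> dot m m = 1 ->
  exists (I : finType) (w : I -> R) (v : I -> 'rV[R]_d.+1),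
  [/\ forall i, 0 <= w i, forall i, dot m (v i) = 0, forall i, dot (v i) (v i) = 1,
    \sum_i w i = 1 &
    forall y, let s2 := dot y y - dot y m ^+ 2 in
    [/\ \sum_i w i * dot y (v i) = 0,
      \sum_i w i * dot y (v i) ^+ 2 = s2 / d%:R,
      \sum_i w i * dot y (v i) ^+ 3 = 0 &
      \sum_i w i * dot y (v i) ^+ 4 = 3 * s2 ^+ 2 / (d%:R * (d%:R + 2))]].
Proof.
move=> hd m1; have [e [me ee esum]] := orthonormal_frame m1.
pose r : R := (Num.sqrt 2)^-1.
have r2 : r ^+ 2 = 2^-1 by rewrite /r exprVn sqr_sqrtr.
have r4 : r ^+ 4 = 4^-1 by rewrite -[4%N]/(2 * 2)%N exprM r2; lra.
have rr : r * (r * 1 + r * 1) = 1 by rewrite mulr1 -mulr2n mulrnAr -expr2 r2; lra.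
(* Half of the nodes suffice: adding the opposite of each node with equal weight kills the odd
   moments. A boolean encodes the sign. *)
suff [l [lw lm l1 lW lM]] : exists l : seq (R * 'rV[R]_d.+1),
  [/\ all (fun p => 0 <= p.1) l, all (fun p => dot m p.2 == 0) l,
    all (fun p => dot p.2 p.2 == 1) l,
    2 * \sum_(p <- l) p.1 = 1 &
    forall y, let s2 := dot y y - dot y m ^+ 2 in
    2 * (\sum_(p <- l) p.1 * dot y p.2 ^+ 2) = s2 / d%:R /\
    2 * (\sum_(p <- l) p.1 * dot y p.2 ^+ 4) = 3 * s2 ^+ 2 / (d%:R * (d%:R + 2))].
  pose t i := tnth (in_tuple l) i.
  have tl i : t i \in l by exact: mem_tnth.
  have sumE (F : R -> 'rV[R]_d.+1 -> R) :
      \sum_(p : 'I_(size l) * bool) F (t p.1).1 ((-1) ^+ p.2 *: (t p.1).2) =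
      \sum_(p <- l) (F p.1 (- p.2) + F p.1 p.2).
    rewrite -(pair_big xpredT xpredT
      (fun i (b : bool) => F (t i).1 ((-1) ^+ b *: (t i).2))).
    rewrite [RHS]big_tnth; apply: eq_bigr => i _.
    by rewrite big_bool /= expr1 expr0 scaleN1r scale1r.
  exists ('I_(size l) * bool)%type, (fun p : _ * bool => (t p.1).1),
    (fun p : _ * bool => (-1) ^+ p.2 *: (t p.1).2); split.
  - by move=> i; exact: (allP lw _ (tl i.1)).
  - by move=> i; rewrite dotZr (eqP (allP lm _ (tl i.1))) mulr0.
  - move=> i; rewrite dotZl dotZr (eqP (allP l1 _ (tl i.1))) mulr1 -expr2.
    by rewrite sqrr_sign.
  - rewrite (sumE (fun w _ => w)) -lW mulr_sumr.
    by apply: eq_bigr => p _; ring.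
  move=> y; have [M2 M4] := lM y; split.
  - rewrite (sumE (fun w v => w * dot y v)) big1// => p _.
    by rewrite dotNr; ring.
  - rewrite (sumE (fun w v => w * dot y v ^+ 2)) -M2 mulr_sumr.
    by apply: eq_bigr => p _; rewrite dotNr; ring.
  - rewrite (sumE (fun w v => w * dot y v ^+ 3)) big1// => p _.
    by rewrite dotNr; ring.
  - rewrite (sumE (fun w v => w * dot y v ^+ 4)) -M4 mulr_sumr.
    by apply: eq_bigr => p _; rewrite dotNr; ring.
case: hd => hd; subst d.
  (* Dimension 2: the regular octagon with equal weights 1/8. *)
  pose a := e ord0; pose b := e (lift ord0 ord0).
  have aa : dot a a = 1 by rewrite ee.
  have bb : dot b b = 1 by rewrite ee.
  have [ab ba] : dot a b = 0 /\ dot b a = 0 by rewrite !ee.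
  have [q qE] : exists q : R, q = 1 / 8 by exists (1 / 8).
  exists [:: (q, a); (q, b); (q, r *: (a + b)); (q, r *: (a - b))].
  split; rewrite /= ?big_cons ?big_nil /=.
  - by rewrite qE !divr_ge0.
  - by rewrite !dot_linear !me !(mulr0, addr0, subr0, oppr0) !eqxx.
  - rewrite !dot_linear aa bb ab ba.
    by rewrite !(subr0, sub0r, add0r, addr0, opprK, mulrN, oppr0) rr !eqxx.
  - by rewrite qE; lra.
  move=> y; have := esum y; rewrite !big_ord_recl big_ord0 -/a -/b addr0.
  move: (dot y y - _) => s2 <-.
  rewrite !big_cons !big_nil /= !dot_linear.
  move: (dot y a) (dot y b) => A B; split.
    transitivity (q * (A ^+ 2 + B ^+ 2) * (2 + 4 * r ^+ 2)); first by ring.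
    by rewrite r2 qE; field.
  transitivity (q * (2 * (A ^+ 4 + B ^+ 4) +
    4 * r ^+ 4 * (A ^+ 4 + 6 * A ^+ 2 * B ^+ 2 + B ^+ 4))); first by ring.
  by rewrite r4 qE; field.
(* Dimension 3: the 6 axis points with weight 1/30 and the 12 normalized edge midpoints of the cube
   with weight 1/15. *)
pose a := e ord0; pose b := e (lift ord0 ord0); pose c := e (lift ord0 (lift ord0 ord0)).
have aa : dot a a = 1 by rewrite ee.
have bb : dot b b = 1 by rewrite ee.
have cc : dot c c = 1 by rewrite ee.
have [ab ba] : dot a b = 0 /\ dot b a = 0 by rewrite !ee.
have [ac ca] : dot a c = 0 /\ dot c a = 0 by rewrite !ee.
have [bc cb] : dot b c = 0 /\ dot c b = 0 by rewrite !ee.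
have [q qE] : exists q : R, q = 1 / 30 by exists (1 / 30).
exists [:: (q, a); (q, b); (q, c); (2 * q, r *: (a + b)); (2 * q, r *: (a - b));
  (2 * q, r *: (a + c)); (2 * q, r *: (a - c));
  (2 * q, r *: (b + c)); (2 * q, r *: (b - c))].
split; rewrite /= ?big_cons ?big_nil /=.
- by rewrite qE !mulr_ge0 ?divr_ge0.
- by rewrite !dot_linear !me !(mulr0, addr0, subr0, oppr0) !eqxx.
- rewrite !dot_linear aa bb cc ab ba ac ca bc cb.
  by rewrite !(subr0, sub0r, add0r, addr0, opprK, mulrN, oppr0) rr !eqxx.
- by rewrite qE; lra.
move=> y; have := esum y; rewrite !big_ord_recl big_ord0 -/a -/b -/c addr0.
move: (dot y y - _) => s2 <-.
rewrite !big_cons !big_nil /= !dot_linear.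
move: (dot y a) (dot y b) (dot y c) => A B C; split.
  transitivity (q * (A ^+ 2 + (B ^+ 2 + C ^+ 2)) * (2 + 16 * r ^+ 2)); first by ring.
  by rewrite r2 qE; field.
transitivity (q * (2 * (A ^+ 4 + B ^+ 4 + C ^+ 4) + 8 * r ^+ 4 *
  (2 * (A ^+ 4 + B ^+ 4 + C ^+ 4) +
   6 * (A ^+ 2 * B ^+ 2 + A ^+ 2 * C ^+ 2 + B ^+ 2 * C ^+ 2)))); first by ring.
by rewrite r4 qE; field.
Qed.

End Designs.

(** * Second-order behaviour along great circles *)

Section Hessian.
Context {R : realType} {d : nat}.
Local Notation V := 'rV[R]_d.+1.

Lemma normalize_sphere (x : V) : sphere R d x -> normalize x = x.
Proof. by rewrite /sphere /normalize /= => ->; rewrite sqrtr1 invr1 scale1r. Qed.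

Lemma nabla1E (F : V -> R) (p : V) (vs : 1.-tuple V) :
  nabla (r := 1) F p vs = 'D_(thead vs) (F \o @normalize R d.+1) p.
Proof. by rewrite /= /covariant_derivative big_ord0 subr0. Qed.

Lemma normalize_in_sphere (x : V) : x != 0 -> sphere R d (normalize x).
Proof.
move=> x0; have q0 := dot_gt0 x0.
rewrite /sphere /normalize /= dotZl dotZr mulrA -expr2 exprVn sqr_sqrtr ?ltW//.
by rewrite mulVf// gt_eqF.
Qed.

(** The one-sided quotients along [z] and [- z] are both nonnegative, and the differential is
    linear. *)
Lemma differential_at_min (W : normedModType R) (f : W -> R) (a z : W) :
  differentiable f a -> (\forall h \near (0 : R), f a <= f (h *: z + a)) ->
  'D_z f a = 0.
Proof.
move=> df fmin.
have ge0 (y : W) : (\forall h \near (0 : R), f a <= f (h *: y + a)) -> 0 <= 'D_y f a.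
  move=> ymin.
  have := diff_derivable (v := y) df; rewrite /derivable => /cvg_dnbhs_at_right L.
  apply: (cvgr_to_ge L); near=> h.
  have h0 : 0 < h by near: h; exact: nbhs_right_gt.
  rewrite mulr_ge0// ?invr_ge0 ?(ltW h0)// subr_ge0 /=.
  by near: h; apply: cvg_within; exact: ymin.
apply/eqP; rewrite eq_le (ge0 _ fmin) andbT.
have : 0 <= 'D_(- z) f a.
  apply: ge0; have /(_ _ fmin) : -%R h @[h --> (0 : R)] --> (0 : R).
    by rewrite -[X in _ --> X]oppr0; exact: oppr_continuous.
  by move=> H; near=> h; rewrite scalerN -scaleNr; near: h; exact: H.
by rewrite !deriveE// linearN oppr_ge0.
Unshelve. all: by end_near. Qed.

Lemma is_derive_great_circle (m v : V) (t : R) :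
  is_derive t 1 (fun t => cos t *: m + sin t *: v) (- sin t *: m + cos t *: v).
Proof.
have c (g : R -> R) (g' : R) (x : V) : is_derive t 1 g g' ->
    is_derive t 1 (fun t => g t *: x) (g' *: x).
  move=> dg.
  have dg1 : differentiable g t by apply/derivable1_diffP; exact: ex_derive.
  have ds : differentiable ( *:%R^~ x : R -> V) (g t).
    exact: (@ex_diff _ _ _ _ _ _ _ (is_diff_scalel _ _)).
  apply: DeriveDef; first by apply/derivable1_diffP; exact: (differentiable_comp dg1 ds).
  rewrite deriveE; last exact: (differentiable_comp dg1 ds).
  rewrite (diff_comp dg1 ds) /= diff_val -deriveE// derive_val//.
exact: (is_deriveD (c _ _ m (is_derive_cos t)) (c _ _ v (is_derive_sin t))).
Qed.

Lemma dot_great_circle (m v : V) (t : R) : dot m m = 1 -> dot m v = 0 ->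
  dot v v = 1 -> sphere R d (cos t *: m + sin t *: v).
Proof.
move=> m1 mv v1; rewrite /sphere /= !dot_linear m1 v1 mv (dotC v m) mv.
rewrite !(mulr0, mulr1, addr0, add0r) -!expr2; exact: cos2Dsin2.
Qed.

(** Along the great circle [g], [psi] is [cos t] times the derivative of [F \o g]. It vanishes at 0
    by minimality, and its derivative there is the Hessian, so [psi (g t)] is o(t). The mean value
    theorem then bounds the increment of [F]; continuity of second derivatives is never invoked. *)
Lemma frechet_hessian_great_circle (F : V -> R) (m v : V) (eta : R) :
  (forall z, sphere R d z -> F m <= F z) ->
  times_differentiable_near 2 F m -> nabla (r := 2) F m [tuple v; v] = 0 ->
  dot m m = 1 -> dot m v = 0 -> dot v v = 1 -> 0 < eta ->
  \forall t \near (0 : R)^'+, F (cos t *: m + sin t *: v) - F m <= eta * t ^+ 2.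
Proof.
move=> Fmin dF hess m1 mv v1 eta0.
pose H := F \o @normalize R d.+1.
pose g t : V := cos t *: m + sin t *: v.
pose psi := teval (nabla (r := 1) F) [tuple v].
have gS t : sphere R d (g t) by exact: dot_great_circle.
have Hg t : H (g t) = F (g t) by rewrite /H /= normalize_sphere.
have g0 : g 0 = m by rewrite /g cos0 sin0 scale1r scale0r addr0.
have dg (t : R) : is_derive t 1 g (- sin t *: m + cos t *: v).
  exact: is_derive_great_circle.
have dgt (t : R) : differentiable g t by apply/derivable1_diffP; exact: ex_derive.
have dg1 (t : R) : 'd g t 1 = - sin t *: m + cos t *: v.
  by rewrite -deriveE//; exact: (@derive_val _ _ _ _ _ _ _ (dg t)).
have near_dH : \forall x \near m, sphere R d x -> differentiable H x.
  by apply: filterS dF => x /[apply] /(_ 0%N [tuple] isT).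
have near_dpsi : \forall x \near m, sphere R d x -> differentiable psi x.
  by apply: filterS dF => x /[apply] /(_ 1%N [tuple v] isT).
have dpsi : differentiable psi m.
  by apply: (nbhs_singleton near_dpsi); rewrite -g0.
have dHm : differentiable H m.
  by apply: (nbhs_singleton near_dH); rewrite -g0.
have psiE x : psi x = 'D_(tproj (normalize x) v) H (normalize x).
  by rewrite /psi /teval nabla1E /thead tnth_mktuple /vfield.
have DHm z : dot m z = 0 -> 'D_z H m = 0.
  move=> mz; apply: (differential_at_min dHm).
  near=> h.
  have n0 : h *: z + m != 0.
    apply/eqP => E; have : dot m (h *: z + m) = 0.
      by rewrite E -(scale0r m) dotZr mul0r.
    by rewrite dotDr dotZr mz mulr0 add0r m1; lra.
  have mS : sphere R d m by [].
  by rewrite /H /= (normalize_sphere mS); exact/Fmin/normalize_in_sphere.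
have tproj_tangent z : dot m (tproj m z) = 0.
  by rewrite /tproj !dot_linear m1 mulr1 subrr.
have psim : psi m = 0.
  have mS : sphere R d m by [].
  by rewrite psiE (normalize_sphere mS) DHm.
(* The connection term of the Hessian is a derivative of [H] at [m] in a tangent direction, hence
   zero by [DHm]. *)
have Dpsi : 'D_v psi m = 0.
  have vE : [tuple of behead [tuple v; v]] = [tuple v] by exact/val_inj.
  have : covariant_derivative (nabla (r := 1) F) m [tuple v; v] = 0 by exact: hess.
  rewrite /covariant_derivative vE big_ord_recl big_ord0 addr0 nabla1E.
  rewrite {2}/thead tnth_mktuple eqxx.
  by rewrite (DHm _ (tproj_tangent _)) subr0.
have dphi (t : R) : differentiable H (g t) ->
    is_derive t 1 (H \o g) ('d H (g t) (- sin t *: m + cos t *: v)).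
  move=> dHt; have dd := differentiable_comp (dgt t) dHt.
  apply: DeriveDef; first exact/derivable1_diffP.
  by rewrite deriveE// (diff_comp (dgt t) dHt) /= dg1.
(* The projection of [v] onto the tangent space at [g t] is [cos t] times the velocity of [g]. *)
have psig t : differentiable H (g t) ->
    psi (g t) = cos t * 'd H (g t) (- sin t *: m + cos t *: v).
  move=> dHt; rewrite psiE normalize_sphere// deriveE//.
  rewrite -[RHS]/(_ *: _) -linearZ /=; congr ('d H (g t) _).
  rewrite /tproj /g !dot_linear v1 mv mulr0 add0r mulr1.
  rewrite !scalerDr !scalerA opprD addrCA; congr (_ + _).
    by rewrite mulrN mulrC -scaleNr.
  by rewrite -[X in X - _]scale1r -scalerBl -!expr2 cos2sin2.
have dpsig : is_derive (0 : R) 1 (psi \o g) 0.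
  rewrite -g0 in dpsi.
  have dd := differentiable_comp (dgt 0) dpsi.
  apply: DeriveDef; first exact/derivable1_diffP.
  rewrite deriveE// (diff_comp (dgt 0) dpsi) /= dg1.
  by rewrite sin0 cos0 oppr0 scale0r add0r scale1r -deriveE// g0.
have L : (h^-1 *: (((psi \o g) \o shift 0) (h *: 1) - (psi \o g) 0))
    @[h --> (0 : R)^'+] --> (0 : R).
  apply: cvg_dnbhs_at_right; have [dv dv0] := dpsig.
  by rewrite -[X in _ --> X]dv0; exact: dv.
have cg : g t @[t --> (0 : R)] --> m.
  by rewrite -[X in _ --> X]g0; exact: differentiable_continuous.
have near_dHg : \forall s \near (0 : R), differentiable H (g s).
  have K : nbhs (0 : R) (g @^-1` (fun x => sphere R d x -> differentiable H x)) :=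
    cg _ near_dH.
  by apply: filterS K => s; apply; exact: gS.
(* Dividing by [cos t >= 1 / 2] costs a factor 2, whence [eta / 2] here. *)
have [e /= e0 He] : \forall t \near (0 : R)^'+,
    [/\ `|psi (g t)| <= eta / 2 * t, 1 / 2 <= cos t & differentiable H (g t)].
  near=> t; have t0 : 0 < t by near: t; exact: nbhs_right_gt.
  split.
  - rewrite mulrC -ler_pdivrMl// -[t^-1]gtr0_norm ?invr_gt0// -normrM.
    near: t.
    apply: filterS (cvgr0_norm_le _ L (eta / 2) (divr_gt0 eta0 (ltr0Sn _ 1))) => h.
    by rewrite /= addr0 g0 psim subr0 [h%:A]mulr1.
  - near: t; apply: cvg_within.
    by apply: (cvgr_ge (cos 0) (@continuous_cos R 0)); rewrite cos0; lra.
  - by near: t; apply: cvg_within; exact: near_dHg.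
exists e => // t /=; rewrite sub0r normrN => te t0.
have inter s : 0 < s <= t -> [/\ `|psi (g s)| <= eta / 2 * s, 1 / 2 <= cos s &
    differentiable H (g s)].
  move=> /andP[s0 st]; apply: He => //=; rewrite sub0r normrN.
  by rewrite gtr0_norm// (le_lt_trans st)// -[t]gtr0_norm.
have dphi' (s : R) : s \in `[0, t] ->
    is_derive s 1 (H \o g) ('d H (g s) (- sin s *: m + cos s *: v)).
  rewrite in_itv /= => /andP[s0 st]; apply: dphi.
  have [->|sn0] := eqVneq s 0; first by rewrite g0.
  by have [] := inter s _; rewrite // lt_def sn0 s0 st.
have -> : F (cos t *: m + sin t *: v) - F m = (H \o g) t - (H \o g) 0.
  by rewrite /= !Hg g0.
have dphi_oo (s : R) : s \in `]0, t[ ->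
    is_derive s 1 (H \o g) ('d H (g s) (- sin s *: m + cos s *: v)).
  by move=> s_in; apply: dphi'; exact: subset_itv_oo_cc s_in.
have cphi : {within `[0, t], continuous (H \o g)}.
  apply: derivable_within_continuous => s s_in.
  by apply: ex_derive; exact: dphi'.
have [s] := MVT t0 dphi_oo cphi.
rewrite in_itv /= => /andP[s0 st] ->; rewrite subr0.
have [|psis coss dHs] := inter s; first by rewrite s0 ltW.
have c0 : 0 < cos s by apply: lt_le_trans coss.
rewrite expr2 mulrA ler_wpM2r ?(ltW t0)//.
apply: (@le_trans _ _ (eta * s)); last by rewrite ler_wpM2l ?ltW.
rewrite -(ler_pM2l c0) -(psig _ dHs) (le_trans (ler_norm _))// (le_trans psis)//.
have := ler_wpM2r (mulr_ge0 (ltW eta0) (ltW s0)) coss; lra.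
Unshelve. all: by end_near. Qed.

End Hessian.

(** * The Fréchet function as an integral *)

Section BoundedMeasurable.
Context d (T : measurableType d) (R : realType) (mu : probability T R).
Variables (A : set T) (mA : measurable A).

Definition bounded_measurable (f : T -> R) :=
  measurable_fun A f /\ exists M, forall x, A x -> `|f x| <= M.

Lemma bounded_measurable_integrable f :
  bounded_measurable f -> mu.-integrable A (EFin \o f).
Proof.
move=> [mf [M fM]]; apply: measurable_bounded_integrable => //.
  by rewrite (le_lt_trans (probability_le1 _ _))// ltry.
exists M; split=> [|N MN x Ax] /=; first exact: num_real.
by rewrite (le_trans (fM _ Ax))// ltW.
Qed.

Lemma bounded_measurable_cst c : bounded_measurable (fun=> c).
Proof. by split; [exact: measurable_cst|exists `|c|]. Qed.

Lemma bounded_measurableD f g : bounded_measurable f -> bounded_measurable g ->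
  bounded_measurable (fun x => f x + g x).
Proof.
move=> [mf [M fM]] [mg [N gN]]; split; first exact: measurable_funD.
by exists (M + N) => x Ax; rewrite (le_trans (ler_normD _ _))// lerD ?fM ?gN.
Qed.

Lemma bounded_measurableM f g : bounded_measurable f -> bounded_measurable g ->
  bounded_measurable (fun x => f x * g x).
Proof.
move=> [mf [M fM]] [mg [N gN]]; split; first exact: measurable_funM.
by exists (M * N) => x Ax; rewrite normrM ler_pM ?fM ?gN.
Qed.

Lemma bounded_measurable_sum (I : Type) (s : seq I) (f : I -> T -> R) :
  (forall i, bounded_measurable (f i)) ->
  bounded_measurable (fun x => \sum_(i <- s) f i x).
Proof.
move=> bf; elim: s => [|i s IH].
  rewrite (_ : (fun _ => _) = fun=> 0); first exact: bounded_measurable_cst.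
  by apply/funext => x; rewrite big_nil.
rewrite (_ : (fun _ => _) = fun x => f i x + \sum_(j <- s) f j x).
  exact: bounded_measurableD.
by apply/funext => x; rewrite big_cons.
Qed.

Lemma Rintegral_sum (I : Type) (s : seq I) (f : I -> T -> R) :
  (forall i, bounded_measurable (f i)) ->
  \int[mu]_(x in A) (\sum_(i <- s) f i x) = \sum_(i <- s) \int[mu]_(x in A) f i x.
Proof.
move=> bf; elim: s => [|i s IH].
  rewrite big_nil -[RHS](mul0r (fine (mu A))) -Rintegral_cst//.
  by apply: eq_Rintegral => x _; rewrite big_nil.
rewrite big_cons -IH -RintegralD//.
- by apply: eq_Rintegral => x _; rewrite big_cons.
- exact: bounded_measurable_integrable.
- exact/bounded_measurable_integrable/bounded_measurable_sum.
Qed.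

End BoundedMeasurable.

(** * The Fréchet integrand in terms of the dot product *)

Section FrechetIntegral.
Context {R : realType} {d : nat}.
Local Notation V := 'rV[R]_d.+1.

Lemma measurable_dot (x : V) : measurable_fun setT (fun y : V => dot y x).
Proof.
rewrite (_ : (fun _ => _) = fun y : V => \sum_(i <- index_enum 'I_d.+1) y 0 i * x 0 i).
  apply: measurable_sum => i; apply: measurable_funM; last exact: measurable_cst.
  by apply: continuous_measurable_rVR => y; exact: coord_continuous.
by apply/funext => y; rewrite dotE.
Qed.

Lemma measurable_sphere : measurable (sphere R d).
Proof.
have := continuous_measurable_rVR (@continuous_dot R d.+1).
move=> /(_ measurableT [set 1] (measurable_set1 _)); rewrite setTI.
by congr measurable; apply/seteqP; split.
Qed.

Lemma measurable_hsa_dot k (E : set V) x : measurable E ->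
  (forall y, E y -> -1 < dot y x < 3) ->
  measurable_fun E (fun y => hsa k (dot y x)).
Proof.
move=> mE Ex.
apply: (@measurable_comp _ _ _ V R R `](-1), 3[%classic (hsa k) E (fun y => dot y x)).
- exact: measurable_itv.
- by move=> _ [y Ey <-]; rewrite /= in_itv /=; exact: Ex.
- apply: open_continuous_measurable_fun; first exact: interval_open.
  move=> c; rewrite inE /= in_itv /= => /andP[c1 c3].
  apply/differentiable_continuous/derivable1_diffP; apply: ex_derive.
  by apply: is_derive_hsa; rewrite ltr_norml; apply/andP; split; lra.
- by apply: measurable_funS (measurable_dot x).
Qed.

Lemma bounded_measurable_hsa_dot k (A : set V) x e : measurable A -> 0 < e ->
  (forall y, A y -> -1 + e <= dot y x <= 1) ->
  bounded_measurable A (fun y => hsa k (dot y x)).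
Proof.
move=> mA e0 Ax; split.
  by apply: measurable_hsa_dot => // y /Ax /andP[? ?]; apply/andP; split; lra.
have m0 : 0 < Num.min e 1 :> R by rewrite lt_min e0 ltr01.
have m1 : Num.min e 1 <= 1 :> R by rewrite ge_min lexx orbT.
have m2 : Num.min e 1 <= e :> R by rewrite ge_min lexx.
have [| | |B _ hB] := @hsa_bounded R (-1 + Num.min e 1) 2 k.+1; [lra..|].
exists B => y /Ax /andP[? ?]; apply: hB => //; apply/andP; split; lra.
Qed.

(** Dropping a null set leaves only points other than the antipode of [x], where [hsaE] applies. *)
Lemma frechet_hsa (mu : probability V R) (A : set V) x : measurable A ->
  A `<=` sphere R d -> mu (sphere R d `\` A) = 0%E -> sphere R d x ->
  (forall y, A y -> -1 < dot y x) ->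
  frechet mu x = \int[mu]_(y in A) hsa 0 (dot y x).
Proof.
move=> mA AS A0 xS Ax.
have mS := measurable_sphere.
have dot1 y : sphere R d y -> -1 <= dot y x <= 1.
  by move=> yS; rewrite -ler_norml; exact: dot_unit_le1.
have mF : measurable_fun (sphere R d) (fun y => gdist y x ^+ 2 / 2).
  (* Measurability is checked piecewise: [hsa 0] represents the integrand on [E], and off [E] the
     distance is the constant [pi]. *)
  pose E : set V := sphere R d `&` (fun y => dot y x) @^-1` `](-1), +oo[%classic.
  have mE : measurable E.
    apply: measurableI => //; rewrite -[X in measurable X]setTI.
    by apply: measurable_dot => //; exact: measurable_itv.
  have -> : sphere R d = E `|` (sphere R d `\` E).
    by apply: esym; apply: setDUK => y [].
  apply/measurable_funU => //; first exact: measurableD.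
  split.
    apply: (eq_measurable_fun (fun y => hsa 0 (dot y x))).
      move=> y; rewrite inE => -[yS /=]; rewrite in_itv /= andbT => yx.
      by have /andP[_ y1] := dot1 _ yS; rewrite hsaE ?yx.
    apply: measurable_hsa_dot => // y [yS /=]; rewrite in_itv /= andbT => ->.
    by have /andP[_ y1] := dot1 _ yS; rewrite (le_lt_trans y1)//; lra.
  apply: (eq_measurable_fun (fun=> pi ^+ 2 / 2)); last exact: measurable_cst.
  move=> y; rewrite inE => -[yS yE]; rewrite /gdist.
  have -> : dot y x = -1; last by rewrite acosN1.
  have /andP[y1 y2] := dot1 _ yS; apply/eqP; rewrite eq_le y1 andbT.
  by rewrite leNgt; apply/negP => yx; apply: yE; split => //=; rewrite in_itv /= yx.
have bF : bounded_measurable (sphere R d) (fun y => gdist y x ^+ 2 / 2).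
  split => //; exists (pi ^+ 2 / 2) => y /dot1 yx.
  have a0 := acos_ge0 yx.
  rewrite ger0_norm ?divr_ge0 ?sqr_ge0// ler_pM2r ?invr_gt0//.
  by rewrite lerXn2r ?nnegrE ?pi_ge0// acos_lepi.
have iF := bounded_measurable_integrable mu mS bF.
have mD : measurable (sphere R d `\` A) by exact: measurableD.
rewrite /frechet /Rintegral (negligible_integral mD mS iF A0).
congr fine; rewrite setDD setIidr//; apply: eq_integral => y; rewrite inE => Ay.
congr EFin; rewrite hsaE ?Ax//.
by have /andP[_ ->] := dot1 _ (AS _ Ay).
Qed.

End FrechetIntegral.

(** * Incompatibility of the expansion with a vanishing Hessian *)

Section Contradiction.
Context {R : realType}.

Lemma near0_sin_bounds : \forall t \near (0 : R)^'+,
  [/\ 0 < t, 0 <= cos t, t / 2 <= sin t & sin t <= t].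
Proof.
have [e /= e0 He] : \forall t \near (0 : R)^'+, 1 / 2 <= cos t.
  apply: cvg_within; apply: (cvgr_ge (cos 0) (@continuous_cos R 0)).
  by rewrite cos0; lra.
exists e => // t /=; rewrite sub0r normrN => te t0.
have [|x] := @MVT R (@sin R) (@cos R) 0 t t0.
  by apply: continuous_subspaceT; exact: continuous_sin.
rewrite in_itv /= => /andP[x0 xt]; rewrite sin0 !subr0 => ->.
have cx : 1 / 2 <= cos x.
  by apply: He => //=; rewrite sub0r normrN gtr0_norm// (lt_trans xt)// -[t]gtr0_norm.
have ct : 1 / 2 <= cos t by apply: He => //=; rewrite sub0r normrN.
split => //; first by lra.
  by rewrite mulrC ler_wpM2r ?(ltW t0)//; lra.
by rewrite ler_piMl ?(ltW t0)// cos_le1.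
Qed.

(** Each of the two displacements is at most [t < e / 2], uniformly in [c] and [b]. *)
Lemma near0_great_circle (e : R) : 0 < e -> \forall t \near (0 : R)^'+,
  forall c b, `|c| <= 1 -> `|b| <= 1 -> c - e <= cos t * c + sin t * b.
Proof.
move=> e0; near=> t => c b; rewrite !ler_norml => /andP[_ c1] /andP[b1 _].
have [t0 ct st1 st2] : [/\ 0 < t, 0 <= cos t, t / 2 <= sin t & sin t <= t].
  by near: t; exact: near0_sin_bounds.
have t1 : t < 1 by near: t; exact: nbhs_right_lt.
have te : t < e / 2 by near: t; apply: nbhs_right_lt; rewrite divr_gt0.
have c2 := cos_le1 t.
have k1 : 1 - cos t <= t.
  have : 1 - cos t <= sin t ^+ 2 by rewrite sin2cos2; nra.
  have : sin t ^+ 2 <= sin t by rewrite expr2 ler_piMl//; lra.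
  by lra.
have : - t <= (cos t - 1) * c by nra.
have : - t <= sin t * b by nra.
by lra.
Unshelve. all: by end_near. Qed.

(** A positive [L] would make [D] grow quadratically, against the last hypothesis. Once [L <= 0],
    the term [- (1 - cos t) ^+ 2 / 16] dominates the fifth-order error and makes [D] negative. *)
Lemma quartic_expansion_absurd (D : R -> R) (L a C : R) : 0 <= a -> 0 <= C ->
  (\forall t \near 0^'+, 0 <= D t) ->
  (\forall t \near 0^'+, D t <= ((1 - cos t) + a * (1 - cos t) ^+ 2) * L +
    (- (1 - cos t) ^+ 2 / 16 + C * sin t ^+ 5)) ->
  (\forall t \near 0^'+, (1 - cos t) * L - C * (1 - cos t) ^+ 2 - C * sin t ^+ 5
    <= D t) ->
  (forall eta, 0 < eta -> \forall t \near 0^'+, D t <= eta * t ^+ 2) -> False.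
Proof.
move=> a0 C0 Dge0 Dle Dge Do.
have ks (t : R) : 0 <= cos t -> 0 <= sin t ->
    [/\ 0 <= 1 - cos t, sin t ^+ 2 / 2 <= 1 - cos t & 1 - cos t <= sin t ^+ 2].
  move=> c0 s0; have c1 := cos_le1 t; rewrite sin2cos2; split; nra.
have C1 : 0 < C + 1 by lra.
have L0 : L <= 0.
  rewrite leNgt; apply/negP => L0.
  (* [L / 16] is half of the growth rate [L / 8] given by [t ^+ 2 / 8 <= 1 - cos t]; the next bound
     on [t] makes the error terms smaller than the other half. *)
  have eta0 : 0 < L / 16 by rewrite divr_gt0.
  have q0 : 0 < L / (32 * (C + 1)) by rewrite divr_gt0// mulr_gt0.
  near (0 : R)^'+ => t.
  have [t0 c0 st ts] : [/\ 0 < t, 0 <= cos t, t / 2 <= sin t & sin t <= t].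
    by near: t; exact: near0_sin_bounds.
  have h1 : D t <= L / 16 * t ^+ 2 by near: t; exact: Do.
  have h2 : (1 - cos t) * L - C * (1 - cos t) ^+ 2 - C * sin t ^+ 5 <= D t by near: t.
  have t1 : t < 1 by near: t; exact: nbhs_right_lt.
  have tq : t < L / (32 * (C + 1)) by near: t; exact: nbhs_right_lt.
  have s0 : 0 <= sin t by lra.
  have [k0 k1 k2] := ks t c0 s0; set k := 1 - cos t in k0 k1 k2 h2.
  have kt : k <= t ^+ 2 by rewrite (le_trans k2)// lerXn2r ?nnegrE ?(ltW t0).
  have kt8 : t ^+ 2 / 8 <= k.
    have : (t / 2) ^+ 2 <= sin t ^+ 2 by rewrite lerXn2r ?nnegrE ?divr_ge0 ?(ltW t0).
    by rewrite expr_div_n; move: k1; lra.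
  have t3 : t ^+ 4 <= t ^+ 3 by rewrite ler_wiXn2l ?(ltW t0) ?(ltW t1).
  have k4 : k ^+ 2 <= t ^+ 3.
    by apply: le_trans t3; rewrite (exprM t 2 2) lerXn2r ?nnegrE ?sqr_ge0.
  have s5 : sin t ^+ 5 <= t ^+ 3.
    apply: (@le_trans _ _ (t ^+ 5)); first by rewrite lerXn2r ?nnegrE ?(ltW t0).
    by rewrite ler_wiXn2l ?(ltW t0) ?(ltW t1).
  have e1 : t ^+ 2 / 8 * L <= k * L by rewrite ler_wpM2r ?(ltW L0).
  have e2 : C * k ^+ 2 <= C * t ^+ 3 by rewrite ler_wpM2l.
  have e3 : C * sin t ^+ 5 <= C * t ^+ 3 by rewrite ler_wpM2l.
  have e4 : t ^+ 2 * (L / 16) <= t ^+ 2 * (2 * C * t).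
    have -> : t ^+ 2 * (2 * C * t) = C * t ^+ 3 + C * t ^+ 3 by ring.
    by move: h1 h2 e1 e2 e3; lra.
  have : L / 16 <= 2 * C * t by rewrite -(ler_pM2l (exprn_gt0 2 t0)).
  have : 32 * (C + 1) * t < L by rewrite mulrC -ltr_pdivlMr// mulr_gt0.
  by have := mulr_ge0 C0 (ltW t0); move: t0; lra.
(* 64 = 16 * 4, because [(1 - cos t) ^+ 2 >= sin t ^+ 4 / 4]. *)
have q0 : 0 < (64 * (C + 1))^-1 by rewrite invr_gt0 mulr_gt0.
near (0 : R)^'+ => t.
have [t0 c0 st ts] : [/\ 0 < t, 0 <= cos t, t / 2 <= sin t & sin t <= t].
  by near: t; exact: near0_sin_bounds.
have h0 : 0 <= D t by near: t.
have h1 : D t <= ((1 - cos t) + a * (1 - cos t) ^+ 2) * L +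
    (- (1 - cos t) ^+ 2 / 16 + C * sin t ^+ 5) by near: t.
have tq : t < (64 * (C + 1))^-1 by near: t; exact: nbhs_right_lt.
have s0 : 0 < sin t by lra.
have [k0 k1 k2] := ks t c0 (ltW s0); set k := 1 - cos t in k0 k1 k2 h1.
have e1 : (k + a * k ^+ 2) * L <= 0.
  by rewrite mulr_ge0_le0// addr_ge0// mulr_ge0// sqr_ge0.
have e2 : sin t ^+ 4 / 4 <= k ^+ 2.
  have -> : sin t ^+ 4 / 4 = (sin t ^+ 2 / 2) ^+ 2 by field.
  by rewrite lerXn2r ?nnegrE ?divr_ge0 ?sqr_ge0.
have e3 : sin t ^+ 4 * (1 / 64) <= sin t ^+ 4 * (C * sin t).
  have -> : sin t ^+ 4 * (C * sin t) = C * sin t ^+ 5 by ring.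
  by move: h0 h1 e1 e2; lra.
have : 1 / 64 <= C * sin t by rewrite -(ler_pM2l (exprn_gt0 4 s0)).
have : 64 * (C + 1) * sin t < 1.
  rewrite mulrC -ltr_pdivlMr ?mulr_gt0// div1r; lra.
by have := mulr_ge0 C0 (ltW s0); lra.
Unshelve. all: by end_near. Qed.

End Contradiction.

(** * Non-vanishing of the Hessian at a minimum *)

Section Main.
Context {R : realType} {d : nat}.
Local Notation V := 'rV[R]_d.+1.

(** The squared Euclidean distance from [y] to [- m] is [2 + 2 * dot y m], and it dominates the
    square of the sup norm that defines balls. *)
Lemma cap_near_antipode (m : V) (U : set V) : sphere R d m -> open U -> U (- m) ->
  exists2 e, 0 < e & forall y, sphere R d y -> dot y m <= -1 + e -> U y.
Proof.
move=> m1 oU Um.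
have /nbhs_ballP[r /= r0 rU] : nbhs (- m) U by exact: open_nbhs_nbhs.
exists (r ^+ 2 / 4) => [|y y1 ym]; first by rewrite divr_gt0// exprn_gt0.
apply: rU; rewrite -ball_normE /= -opprD normrN addrC.
apply/mx_norm_ltP => // i j; rewrite ord1.
have D : dot (y + m) (y + m) < r ^+ 2.
  rewrite !dot_linear (m1 : dot m m = 1) (y1 : dot y y = 1) (dotC m y).
  have r2 : 0 < r ^+ 2 by rewrite exprn_gt0.
  by move: ym r2; lra.
rewrite -(@ltr_pXn2r _ 2)// ?nnegrE// ?(ltW r0)// real_normK ?num_real//.
apply: le_lt_trans D; rewrite dotE (bigD1 j)//= -expr2 lerDl sumr_ge0// => k _.
by rewrite -expr2 sqr_ge0.
Qed.

Lemma frechet_min_hessian_nonzero (mu : probability V R) (m : V) (U : set V) :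
  d = 2%N \/ d = 3%N -> mu (sphere R d) = 1%E -> sphere R d m ->
  (forall z, sphere R d z -> frechet mu m <= frechet mu z) ->
  open U -> U (- m) -> mu U = 0%E ->
  times_differentiable_near 2 (frechet mu) m ->
  ~ (forall v, tangent m v -> nabla (r := 2) (frechet mu) m [tuple v; v] = 0).
Proof.
move=> hd muS m1 mmin oU Um muU dF hess.
have [e e0 capU] := cap_near_antipode m1 oU Um.
have mS := @measurable_sphere R d.
pose A : set V := sphere R d `&` (fun y => dot y m) @^-1` `](-1 + e), +oo[%classic.
have AE y : A y -> sphere R d y /\ -1 + e < dot y m.
  by move=> [yS /=]; rewrite in_itv /= andbT.
have AS : A `<=` sphere R d by move=> y [].
have mA : measurable A.
  apply: measurableI => //; rewrite -[X in measurable X]setTI.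
  by apply: measurable_dot => //; exact: measurable_itv.
have mSA : measurable (sphere R d `\` A) by exact: measurableD.
have A0 : mu (sphere R d `\` A) = 0%E.
  apply: (subset_measure0 mSA (open_measurable_rV oU)) => //= y [yS yA].
  apply: capU => //; rewrite leNgt; apply/negP => ym; apply: yA; split => //=.
  by rewrite in_itv /= ym.
have A1 : mu A = 1%E.
  rewrite -muS -[in RHS](setDUK AS) measureU//; first by rewrite [X in (_ + X)%E]A0 adde0.
  by rewrite setIDA setIC -setIDA setDv setI0.
(* Half of the margin [e] pays for moving from [m] to the nodes [X t i]. *)
have e20 : 0 < e / 2 by rewrite divr_gt0.
have n23 : d%:R = 2 :> R \/ d%:R = 3 :> R by case: hd => ->; [left|right].
have [I [w [v [w0 mv v1 W M]]]] := tangent_design hd m1.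
have [C C0 HC] := mean_expansion n23 e20.
pose X t i : V := cos t *: m + sin t *: v i.
pose F := frechet mu.
have XS t i : sphere R d (X t i) by exact: dot_great_circle.
have FE x : sphere R d x -> (forall y, A y -> -1 < dot y x) ->
    F x = \int[mu]_(y in A) hsa 0 (dot y x).
  by move=> xS Ax; exact: frechet_hsa.
have dot1 x y : sphere R d x -> A y -> dot y x <= 1.
  move=> xS /AS yS; rewrite (le_trans (ler_norm _))//; exact: dot_unit_le1.
pose L y := mean_lap d%:R (dot y m) (hsa 1 (dot y m)).
have bm k : bounded_measurable A (fun y => hsa k (dot y m)).
  apply: (bounded_measurable_hsa_dot _ mA e0) => y Ay.
  by rewrite (ltW (AE _ Ay).2) dot1.
have bdot : bounded_measurable A (fun y => dot y m).
  split; first exact: measurable_funS (measurable_dot m).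
  by exists 1 => y /AS yS; exact: dot_unit_le1.
have bL : bounded_measurable A L.
  apply: bounded_measurableM; last exact: bounded_measurable_cst.
  apply: bounded_measurableD; first exact: bounded_measurable_cst.
  rewrite (_ : (fun _ => _) = fun y => (- (d%:R - 1)) * (dot y m * hsa 1 (dot y m))).
    apply: bounded_measurableM; first exact: bounded_measurable_cst.
    exact: bounded_measurableM.
  by apply/funext => y; ring.
pose IL := \int[mu]_(y in A) L y.
pose D t := \sum_i w i * F (X t i) - F m.
have intcst (c : R) : \int[mu]_(y in A) c = c.
  by rewrite Rintegral_cst// -[RHS]mulr1; congr (c * _); exact: (congr1 fine A1).
(* Both bounds on [D t] are affine in [L y]: the quartic coefficient is estimated pointwise and is
   itself never integrated. *)
have intAff a c : \int[mu]_(y in A) (a * L y + c) = a * IL + c.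
  rewrite RintegralD//.
  - by rewrite RintegralZl ?intcst//; exact: bounded_measurable_integrable.
  - apply: bounded_measurable_integrable => //; apply: bounded_measurableM => //.
    exact: bounded_measurable_cst.
  - apply: bounded_measurable_integrable => //; exact: bounded_measurable_cst.
have bAff a c : bounded_measurable A (fun y => a * L y + c).
  apply: bounded_measurableD; last exact: bounded_measurable_cst.
  by apply: bounded_measurableM => //; exact: bounded_measurable_cst.
have near_circle := near0_great_circle e20.
have good : \forall t \near (0 : R)^'+, [/\ 0 < t, 0 <= cos t, 0 <= sin t &
    forall y i, A y -> -1 + e / 2 <= dot y (X t i)].
  near=> t.
  have [t0 ct st1 st2] : [/\ 0 < t, 0 <= cos t, t / 2 <= sin t & sin t <= t].
    by near: t; exact: near0_sin_bounds.
  have st0 : 0 <= sin t by apply: le_trans st1; rewrite divr_ge0 ?(ltW t0).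
  split => // y i Ay; have [yS ym] := AE _ Ay.
  have c1 : `|dot y m| <= 1 by exact: dot_unit_le1.
  have b1 : `|dot y (v i)| <= 1 by exact: dot_unit_le1.
  rewrite /X !dot_linear; apply: le_trans (near near_circle t _ _ _ c1 b1) => //.
  by move: ym; lra.
have DE t : 0 < t -> (forall y i, A y -> -1 + e / 2 <= dot y (X t i)) ->
    let G y := \sum_i w i * hsa 0 (dot y (X t i)) - hsa 0 (dot y m) in
    D t = \int[mu]_(y in A) G y /\ bounded_measurable A G.
  move=> t0 Xt G.
  have bX i : bounded_measurable A (fun y => hsa 0 (dot y (X t i))).
    by apply: (bounded_measurable_hsa_dot _ mA e20) => y Ay; rewrite Xt// dot1.
  have bwX i : bounded_measurable A (fun y => w i * hsa 0 (dot y (X t i))).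
    by apply: bounded_measurableM => //; exact: bounded_measurable_cst.
  have bsum := bounded_measurable_sum (index_enum I) bwX.
  split.
    rewrite RintegralB//; [|exact: bounded_measurable_integrable..].
    rewrite Rintegral_sum// /D FE// => [|y Ay]; last by have := (AE _ Ay).2; lra.
    congr (_ - _); apply: eq_bigr => i _.
    rewrite RintegralZl//; last exact: bounded_measurable_integrable.
    by rewrite FE// => y Ay; have := Xt y i Ay; lra.
  apply: bounded_measurableD => //.
  rewrite (_ : (fun _ => _) = fun y => -1 * hsa 0 (dot y m)).
    by apply: bounded_measurableM => //; exact: bounded_measurable_cst.
  by apply/funext => y; rewrite mulN1r.
have ptw t y : 0 < t -> 0 <= cos t -> 0 <= sin t ->
    (forall y i, A y -> -1 + e / 2 <= dot y (X t i)) -> A y ->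
    let c := dot y m in let k := 1 - cos t in
    let J := mean_quartic d%:R c (hsa 2 c) (hsa 3 c) (hsa 4 c) in
    `|\sum_i w i * hsa 0 (dot y (X t i)) - hsa 0 c - k * L y - k ^+ 2 * J|
      <= C * sin t ^+ 5 /\ `|J| <= C.
  move=> t0 ct st Xt Ay c k J; have [yS ym] := AE _ Ay.
  have [M1 M2 M3 M4] := M y; rewrite (yS : dot y y = 1) in M2 M4.
  have XE i : dot y (X t i) = (1 - k) * c + sin t * dot y (v i).
    by rewrite /X !dot_linear /k subKr.
  have -> : \sum_i w i * hsa 0 (dot y (X t i)) =
      \sum_i w i * hsa 0 ((1 - k) * c + sin t * dot y (v i)).
    by apply: eq_bigr => i _; rewrite XE.
  apply: (HC I (index_enum I) w (fun i => dot y (v i)) c k (sin t)) => //.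
  - by rewrite dot1// andbT /c; move: ym; lra.
  - by have := cos_le1 t; rewrite /k; move: ct; lra.
  - by rewrite sin2cos2 /k; ring.
  - by move=> i; rewrite -XE Xt// dot1.
  - by move=> i; apply: dot_unit_le1.
(* In order: minimality of [m]; the upper bound through [mean_quartic_le]; the lower bound through
   [|J| <= C]; the vanishing Hessian. *)
apply: (@quartic_expansion_absurd R D IL ((d%:R + 3) / 20) C) => //.
- near=> t; rewrite /D subr_ge0 -[F m]mul1r -W mulr_suml.
  by apply: ler_sum => i _; rewrite ler_wpM2l// mmin.
- apply: filterS good => t [t0 ct st Xt].
  have [-> bG] := DE _ t0 Xt; rewrite -intAff.
  apply: le_Rintegral => //; [exact: bounded_measurable_integrable..|].
  move=> y Ay; have [] := ptw _ _ t0 ct st Xt Ay; rewrite ler_norml => /andP[_ H] _.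
  have c2 : `|1 - dot y m| < 2.
    have := (AE _ Ay).2; have := dot1 _ _ m1 Ay.
    by rewrite ltr_norml => ? ?; apply/andP; split; lra.
  have := mean_quartic_le n23 c2 (dot1 _ _ m1 Ay); rewrite -/(L y).
  move=> /(ler_wpM2l (sqr_ge0 (1 - cos t))); move: H.
  by move: (hsa 0 _) (mean_quartic _ _ _ _ _) (L y) => h J l; lra.
- apply: filterS good => t [t0 ct st Xt].
  have [-> bG] := DE _ t0 Xt.
  rewrite -addrA -intAff;
  apply: le_Rintegral => //; [exact: bounded_measurable_integrable..|].
  move=> y Ay; have [] := ptw _ _ t0 ct st Xt Ay.
  rewrite !ler_norml => /andP[H _] /andP[J1 _].
  have := ler_wpM2l (sqr_ge0 (1 - cos t)) J1; move: H.
  by move: (hsa 0 _) (mean_quartic _ _ _ _ _) (L y) => h J l; lra.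
move=> eta eta0.
(* There are finitely many nodes, so their neighbourhoods of 0 intersect in one. *)
have near_i i : \forall t \near (0 : R)^'+, F (X t i) - F m <= eta * t ^+ 2.
  by apply: frechet_hessian_great_circle => //; apply: hess; exact: mv.
apply: filterS (filter_forall _ near_i) => t Ht.
have -> : D t = \sum_i w i * (F (X t i) - F m).
  under eq_bigr do rewrite mulrBr.
  by rewrite sumrB -mulr_suml W mul1r.
rewrite -[leRHS]mul1r -W mulr_suml; apply: ler_sum => i _.
by rewrite ler_wpM2l.
Unshelve. all: by end_near. Qed.

End Main.

Theorem corollary2p11 (R : realType) (d : nat) (hd : d = 2%N \/ d = 3%N)
    (mu : probability 'rV[R]_d.+1 R)
    (mu_sphere : mu (sphere R d) = 1%E)
    (m : 'rV[R]_d.+1)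
    (mean_unique : frechet_mean_set mu = [set m])
    (f : R -> R)
    (f_measurable : measurable_fun `[0, pi]%classic f)
    (f_ge0 : forall t, t \in `[0, pi] -> 0 <= f t)
    (mu_density : forall A, measurable A ->
       mu A = (\int[sphere_volume R d]_(y in A `&` sphere R d)
                 (f (gdist m y))%:E)%E)
    (U : set 'rV[R]_d.+1) (U_open : open U) (U_antipode : U (- m))
    (mu_U : mu U = 0%E) :
  ~ smeary mu m.
Proof.
have [mS mmin] : frechet_mean_set mu m by rewrite mean_unique.
move=> [hess [r [r0 r_even dr _]]].
apply: (frechet_min_hessian_nonzero hd mu_sphere mS mmin U_open U_antipode mu_U).
  apply: filterS dr => x + xS k vs k2 => /(_ xS k vs); apply.
  (* A positive even order is at least 2, so differentiability up to order [r] includes order 2. *)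
  by case: r r0 r_even => [//|[//|r]] _ _; exact: leq_trans k2 _.
by move=> v mv; exact: hess.
Qed.
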